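(* Let $Z\subset \mathbb{P}V$ be an Euler-symmetric projective variety corresponding to a symbol system $\mathbf{F}$ of rank $r\geq 3$; that is, $Z\subset\mathbb{P}V$ is (up to a linear isomorphism $V\cong V_{\mathbf F}$) the variety $M(\mathbf{F})\subset \mathbb{P}V_{\mathbf{F}}$. Then $Z\subset \mathbb{P}V$ is not a complete intersection.
   Context: Everything is over $\mathbb{C}$. $\mathbb{P}V$ denotes the space of one-dimensional subspaces of $V$. Symbol systems. Let $W$ be a finite-dimensional complex vector space and $\operatorname{Sym}(W^* )=\bigoplus_{k\ge 0}\operatorname{Sym}^kW^*$, where elements of $\operatorname{Sym}^kW^*$ are viewed as symmetric $k$-linear forms on $W$ (equivalently, homogeneous polynomials of degree $k$). For $w\in W$ let $\iota_w:\operatorname{Sym}^{k+1}W^*\to\operatorname{Sym}^kW^*$ be $\iota_w\varphi(w_1,\dots,w_k)=\varphi(w,w_1,\dots,w_k)$. For a subspace $F^k\subset\operatorname{Sym}^kW^*$ put $\mathbf{prolong}(F^k)=\bigcap_{w\in W}\iota_w^{-1}(F^k)\subset \operatorname{Sym}^{k+1}W^*$. A graded subspace $\mathbf{F}=\bigoplus_{k\ge0}F^k\subset\operatorname{Sym}(W^* )$ with $F^0=\mathbb{C}$, $F^1=W^*$, $F^r\neq0$, $F^{r+i}=0$ for all $i\ge1$ is a symbol system of rank $r$ if $F^{k+1}\subset\mathbf{prolong}(F^k)$ for all $1\le k\le r$. The variety $M(\mathbf F)$. For $w\in W$ let $\iota_w^k\in(F^k)^*$ be the functional $\phi\mapsto\phi(w,\dots,w)$.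 Put $V_{\mathbf F}=\mathbb{C}\oplus W\oplus(F^2)^*\oplus\cdots\oplus(F^r)^*$ and let $\phi_{\mathbf F}:\mathbb{P}(\mathbb{C}\oplus W)\dashrightarrow\mathbb{P}V_{\mathbf F}$ be the rational map $[t:w]\mapsto[t^r:t^{r-1}w:t^{r-2}\iota_w^2:\cdots:t\,\iota_w^{r-1}:\iota_w^r]$. $M(\mathbf F)\subset\mathbb{P}V_{\mathbf F}$ is the Zariski closure of the image of $\phi_{\mathbf F}$. Euler-symmetric varieties are, up to projective equivalence, exactly the varieties $M(\mathbf F)$ for symbol systems $\mathbf F$ (a known result), and $\mathbf F$ is then the corresponding symbol system (the system of fundamental forms at a general point). A subvariety $Z$ of dimension $n$ in $\mathbb{P}^{n+c}$ is a complete intersection if its homogeneous vanishing ideal $I(Z)$ can be generated by $c$ elements. *)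

(* Defs.v *)
From HB Require Import structures.
From mathcomp Require Import all_boot all_order all_algebra all_fingroup.
From mathcomp Require Import reals complex mpoly.

Set Implicit Arguments.
Unset Strict Implicit.
Unset Printing Implicit Defensive.

Import GRing.Theory.
Local Open Scope ring_scope.

(* The field of complex numbers is R[i], where R : realType.                  *)

Section MultilinearForms.
Variables (R : realType) (W : vectType R[i]).

(* k-linear forms on W, curried: Hom(W, Hom(W, ... Hom(W, C))).  With this    *)
(* encoding the contraction iota_w phi is the application phi w.              *)
Fixpoint mform (k : nat) : vectType R[i] :=
  if k is k'.+1 then 'Hom(W, mform k') else R[i]^o.

(* phi(w_1, ..., w_k) *)
Fixpoint mapply (k : nat) : mform k -> ('I_k -> W) -> R[i] :=
  match k return mform k -> ('I_k -> W) -> R[i] with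
  | 0 => fun phi _ => phi
  | k'.+1 => fun (phi : 'Hom(W, mform k')) w =>
      mapply (phi (w ord0)) (fun i => w (lift ord0 i))
  end.

Definition iota_form (k : nat) (w : W) (phi : mform k.+1) : mform k :=
  (phi : 'Hom(W, mform k)) w.

(* membership in Sym^k W^* *)
Definition symform (k : nat) (phi : mform k) : Prop :=
  forall (s : 'S_k) (w : 'I_k -> W),
    mapply phi (fun i => w (s i)) = mapply phi w.

Definition prolong (k : nat) (Fk : {vspace mform k}) (phi : mform k.+1) : Prop :=
  symform phi /\ forall w : W, iota_form w phi \in Fk.

Record symbol_system (r : nat) (F : forall k, {vspace mform k}) : Prop :=
  SymbolSystem {
    ss_sym : forall k (phi : mform k), phi \in F k -> symform phi;
    ss_F0 : F 0%N = fullv;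
    ss_F1 : F 1%N = fullv;
    ss_top : F r <> 0%VS;
    ss_above : forall i, (1 <= i)%N -> F (r + i)%N = 0%VS;
    ss_prolong : forall k, (1 <= k <= r)%N ->
      forall phi : mform k.+1, phi \in F k.+1 -> prolong (F k) phi
  }.

Definition dual (U : vectType R[i]) : vectType R[i] := 'Hom(U, R[i]^o).

Definition mdiag (k : nat) (w : W) (phi : mform k) : R[i]^o :=
  mapply phi (fun _ => w).

Lemma mdiag_is_linear (k : nat) (w : W) : linear (@mdiag k w).
Proof.
elim: k => [|k IH] a u v //=.
by rewrite /mdiag /= add_lfunE scale_lfunE; exact: IH.
Qed.

HB.instance Definition _ (k : nat) (w : W) :=
  GRing.isLinear.Build R[i] (mform k) R[i]^o _ (@mdiag k w)
    (@mdiag_is_linear k w).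

Variable F : forall k, {vspace mform k}.

(* the functional iota_w^k : phi |-> phi(w, ..., w) on F^k *)
Definition iota_pow (k : nat) (w : W) : dual (subvs_of (F k)) :=
  linfun (@mdiag k w \o vsval).

Lemma iota_powE (k : nat) (w : W) (phi : subvs_of (F k)) :
  (iota_pow k w : 'Hom(_, _)) phi = mdiag w (vsval phi).
Proof. exact: lfunE. Qed.

(* V_F r = C (+) W (+) (F^2)^* (+) ... (+) (F^r)^* , nested to the left *)
Fixpoint VF (r : nat) : vectType R[i] :=
  match r with
  | 0 => R[i]^o
  | 1 => (R[i]^o * W)%type
  | r'.+1 => (VF r' * dual (subvs_of (F r)))%type
  end.

(* The components t^(d-k) iota_w^k, 0 <= k <= r, in VF r.  The total degree d *)
(* stays fixed along the recursion on r; phi_F is the case d = r.             *)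
Fixpoint phi_components (d r : nat) (t : R[i]) (w : W) : VF r :=
  match r return VF r with
  | 0 => t ^+ d
  | r'.+1 =>
      match r' return VF r' -> VF r'.+1 with
      | 0 => fun v => (v, t ^+ d.-1 *: w)
      | r''.+1 => fun v => (v, t ^+ (d - r''.+2) *: iota_pow r''.+2 w)
      end (phi_components d r' t w)
  end.

Definition phi_map (r : nat) (t : R[i]) (w : W) : VF r :=
  phi_components r r t w.

End MultilinearForms.

Section ProjectiveGeometry.
Variables (R : realType) (V : vectType R[i]).

(* P V : the one-dimensional subspaces of V *)
Definition proj := {U : {vspace V} | \dim U == 1%N}.

(* C[V] = Sym(V^* ), written in the linear coordinates on V given by the      *)
(* library's chosen basis of V.                                               *)
Definition evalv (p : {mpoly R[i][\dim {:V}]}) (v : V) : R[i] :=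
  p.@[fun i => coord (vbasis {:V}) i v].

Definition vanishes_at (p : {mpoly R[i][\dim {:V}]}) (P : proj) : Prop :=
  forall v : V, v \in val P -> evalv p v = 0.

Definition zclosed (Z : proj -> Prop) : Prop :=
  exists E : {mpoly R[i][\dim {:V}]} -> Prop,
    (forall p, E p -> exists d : nat, p \is d.-homog) /\
    (forall P, Z P <-> forall p, E p -> vanishes_at p P).

Definition psubset (A B : proj -> Prop) : Prop := forall P, A P -> B P.

Definition zclosure (A : proj -> Prop) (P : proj) : Prop :=
  forall B, zclosed B -> psubset A B -> B P.

Definition zirreducible (Z : proj -> Prop) : Prop :=
  [/\ zclosed Z, exists P, Z P
    & forall A B, zclosed A -> zclosed B ->
        (forall P, Z P -> A P \/ B P) -> psubset Z A \/ psubset Z B].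

(* Z_0 < Z_1 < ... < Z_m, irreducible closed subsets contained in Z *)
Definition irr_chain (Z : proj -> Prop) (m : nat) (c : nat -> proj -> Prop) :
    Prop :=
  (forall i, (i <= m)%N -> zirreducible (c i) /\ psubset (c i) Z) /\
  (forall i, (i < m)%N -> psubset (c i) (c i.+1) /\ ~ psubset (c i.+1) (c i)).

(* Krull dimension for the Zariski topology *)
Definition pdim (Z : proj -> Prop) (n : nat) : Prop :=
  (exists c, irr_chain Z n c) /\
  (forall m c, irr_chain Z m c -> (m <= n)%N).

(* The homogeneous ideal I(Z): its degree d part consists of the forms of     *)
(* degree d vanishing on Z.                                                   *)
Definition hideal (Z : proj -> Prop) (p : {mpoly R[i][\dim {:V}]}) : Prop :=
  forall (d : nat) (P : proj), Z P -> vanishes_at (pihomog mdeg d p) P.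

Definition generated_by (I : {mpoly R[i][\dim {:V}]} -> Prop) (c : nat)
    (f : 'I_c -> {mpoly R[i][\dim {:V}]}) : Prop :=
  forall p, I p <->
    exists g : 'I_c -> {mpoly R[i][\dim {:V}]}, p = \sum_(i < c) g i * f i.

Definition complete_intersection (Z : proj -> Prop) : Prop :=
  exists n c : nat,
    [/\ pdim Z n, \dim {:V} = (n + c).+1 & exists f, @generated_by (hideal Z) c f].

End ProjectiveGeometry.

Section EulerSymmetric.
Variables (R : realType) (W : vectType R[i]).
Variables (F : forall k, {vspace mform W k}) (r : nat).

(* A point <[v]> is one-dimensional, so val P = <[v]> forces v != 0: the      *)
(* indeterminacy locus of phi_F contributes nothing.                          *)
Definition phi_image (P : proj (VF F r)) : Prop :=
  exists (t : R[i]) (w : W), val P = <[phi_map F r t w]>%VS.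

Definition MF : proj (VF F r) -> Prop := zclosure phi_image.

(* Z is carried onto M(F) by a linear isomorphism V -> V_F *)
Definition euler_symmetric_for (V : vectType R[i]) (Z : proj V -> Prop) : Prop :=
  exists f : 'Hom(V, VF F r),
    bijective f /\
    forall P : proj V,
      Z P <-> exists Q : proj (VF F r), MF Q /\ val Q = (f @: val P)%VS.

End EulerSymmetric.

(* Main.v *)
Require Import Defs.
From HB Require Import structures.
From mathcomp Require Import all_boot all_order all_algebra all_fingroup.
From mathcomp Require Import fraction reals complex mpoly boolp zify.

(** Write the points of Z in coordinates given by bases of the spaces F^k: over
    w in W such a coordinate is phi(w, ..., w) with phi in F^k, and it gets the
    weight k.  There is one coordinate x_0 of weight 0, the coordinates of
    weight 1 are linear coordinates on W, and N = sum_(k >= 2) dim F^k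
    coordinates are left.  The affine cone over Z is the closure of the points
    s (phi(w, ..., w))_phi, so its ideal J is graded by degree and by weight.

    Suppose that c <= N elements f_i generate J.  The derivatives of an element
    of J in the N coordinates of weight at least 2, restricted to the x_0-axis,
    form a vector over C[x_0] that depends C[x_0]-linearly on the coefficients
    g_i of sum_i g_i f_i.  These vectors have rank N, because J contains the
    equations x_0^(k-1) x_i - q_i(x) of the graph; hence those of the f_i are
    linearly independent, and sum_i g_i f_i has vector 0 only if all g_i vanish
    on the axis, in particular g_i(0) = 0.  An element of J of weight above r
    has vector 0, since x_0^(d-1) x_i has weight at most r.

    Let L be the linear space on which all coordinates of weight at most r/2
    vanish.  Then all of J vanishes on L (few_generators_vanish), by induction
    on the degree d of a bihomogeneous element.  If its weight is at most r and
    d >= 2, every monomial contains a coordinate of weight at most r/2; there is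
    nothing in degree at most 1, as the cone spans.  If its weight exceeds r, it
    is sum_i g_i f_i with g_i(0) = 0, so only components of the f_i of degree
    below d contribute to its degree d part, and they vanish on L.

    For r >= 3 this is absurd (exists_relation).  Let phi <> 0 in F^r depend on
    exactly m variables.  Its m partial derivatives lie in F^(r-1), are linearly
    independent, and together with phi they are m + 1 polynomials in m
    variables, hence satisfy a relation Q (algebraic_dependence).  Homogenising
    Q by x_0 gives an element of J whose restriction to x_0 = 0 is the leading
    form of Q in m + 1 independent linear coordinates of weights r - 1 and r.
    Both weights exceed r/2, so this element does not vanish on L.

    It remains to see that a complete intersection has c <= N, i.e. that the
    dimension of Z is at least dim W (dim_Z_ge): the closures of the images of
    a flag of subspaces of W form a chain of irreducible closed subsets. *)

Set Implicit Arguments.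
Unset Strict Implicit.
Unset Printing Implicit Defensive.

Import GRing.Theory Num.Theory.
Local Open Scope ring_scope.

(** * Polynomial functions over an infinite field *)

Section WeightedLines.
Variables (K : numFieldType).

(** The point 0 is left out because forms are first known to vanish on Z away
    from the locus t = 0. *)
Lemma poly_eq0_fun (p : {poly K}) : (forall s, s != 0 -> p.[s] = 0) -> p = 0.
Proof.
move=> p0; apply/eqP; apply/negPn/negP => nz.
pose rs := [seq (i.+1%:R : K) | i <- iota 0 (size p)].
have H1 : all (root p) rs.
  by apply/allP => x /mapP[i _ ->]; rewrite rootE p0 // pnatr_eq0.
have H2 : uniq rs.
  rewrite map_inj_uniq ?iota_uniq // => i j /eqP.
  by rewrite eqr_nat => /eqP[].
by move: (@max_poly_roots _ p rs nz H1 H2); rewrite size_map size_iota ltnn.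
Qed.

Variable (n : nat).

Definition mwt (om : 'I_n -> nat) (m : 'X_{1..n}) : nat := (\sum_i m i * om i)%N.

Lemma mwt0 om : mwt om 0%MM = 0%N.
Proof. by rewrite /mwt big1 // => i _; rewrite mnm0E. Qed.

Lemma mwtD om : {morph mwt om : m1 m2 / (m1 + m2)%MM >-> (m1 + m2)%N}.
Proof.
by move=> m1 m2; rewrite /mwt -big_split; apply: eq_bigr => i _; rewrite mnmDE mulnDl.
Qed.

HB.instance Definition _ om := isMeasure.Build n (mwt om) (mwt0 om) (mwtD om).

Lemma mcoeff_pihomog (mf : measure n) d (p : {mpoly K[n]}) m :
  (pihomog mf d p)@_m = if mf m == d then p@_m else 0.
Proof.
rewrite {2}(mpolyE p) pihomogE !raddf_sum /= big_mkcond /=.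
case: ifP => [md|md]; last first.
  apply: big1 => m' _; case: ifP => // m'd; rewrite mcoeffZ mcoeffX.
  by case: eqP => [e|_]; rewrite ?mulr0 //; rewrite -e m'd in md.
apply: eq_bigr => m' _; case: ifP => // m'd; rewrite mcoeffZ mcoeffX.
by case: eqP => [e|_]; rewrite ?mulr0 //; rewrite -e m'd in md.
Qed.

(** Restriction to the curve s |-> (s^(om i) v_i)_i. Its coefficients are the
    values at v of the weighted homogeneous components, so vanishing along the
    curve can be read component by component; constant weights 1 give the line
    through v and the ordinary grading. *)
Definition wline (om : 'I_n -> nat) (v : 'I_n -> K) : {mpoly K[n]} -> {poly K} :=
  mmap (@polyC K) (fun i => v i *: 'X^(om i)).

HB.instance Definition _ om v := GRing.RMorphism.on (wline om v).

Lemma wlineE om v p :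
  wline om v p = \sum_(m <- msupp p) (p@_m * \prod_i v i ^+ m i) *: 'X^(mwt om m).
Proof.
apply: eq_bigr => m _; rewrite /mmap1 mul_polyC -scalerA; congr (_ *: _).
rewrite /mwt expr_sum -mul_polyC rmorph_prod -big_split /=.
by apply: eq_bigr => i _; rewrite exprZn -exprM mulnC mul_polyC.
Qed.

Lemma horner_wline om v p s :
  (wline om v p).[s] = p.@[fun i => s ^+ om i * v i].
Proof.
rewrite wlineE mevalE horner_sum; apply: eq_bigr => m _.
rewrite hornerZ hornerXn /mwt expr_sum -mulrA -big_split /=; congr (_ * _).
by apply: eq_bigr => i _; rewrite exprMn -exprM mulnC mulrC.
Qed.

Lemma coef_wline om v p d : (wline om v p)`_d = (pihomog (mwt om) d p).@[v].
Proof.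
rewrite wlineE coef_sum pihomogE raddf_sum /= [RHS]big_mkcond /=.
apply: eq_bigr => m _; rewrite coefZ coefXn eq_sym.
by case: eqP; rewrite ?mulr0 // mulr1 mevalZ mevalX.
Qed.

(** The ideal of a set stable under a weighted scaling is homogeneous for
    these weights. *)
Lemma pihomog_vanish om v (p : {mpoly K[n]}) :
  (forall s, p.@[fun i => s ^+ om i * v i] = 0) ->
  forall d, (pihomog (mwt om) d p).@[v] = 0.
Proof.
move=> p0 d; rewrite -coef_wline (_ : wline om v p = 0) ?coef0 //.
by apply: poly_eq0_fun => s _; rewrite horner_wline.
Qed.

(** Splitting off the component of degree m0 j in the variable j, for all j in
    turn, isolates the monomial m0, and every component of a polynomial that
    vanishes everywhere does so too. *)
Lemma mpoly_eq0_fun (p : {mpoly K[n]}) : (forall x, p.@[x] = 0) -> p = 0.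
Proof.
move=> p0; apply/mpolyP => m0; rewrite mcoeff0.
pose q := foldr (fun j => pihomog (mwt (fun i => (i == j) : nat)) (m0 j)) p.
have mwt1 j m : mwt (fun i => (i == j) : nat) m = m j.
  rewrite /mwt (bigD1 j) //= eqxx muln1 big1 ?addn0 // => i /negPf->.
  by rewrite muln0.
have q0 js x : (q js).@[x] = 0.
  by elim: js x => //= j js IH x; apply: pihomog_vanish => s; apply: IH.
have qE js m : (q js)@_m = if all (fun j => m j == m0 j) js then p@_m else 0.
  elim: js => //= j js IH; rewrite mcoeff_pihomog /= mwt1 IH.
  by case: eqP.
have qX : q (enum 'I_n) = p@_m0 *: 'X_[m0].
  apply/mpolyP => m; rewrite qE mcoeffZ mcoeffX.
  case: eqP => [<-|ne]; first by rewrite mulr1 (_ : all _ _) //; apply/allP => j _.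
  rewrite mulr0; case: ifP => // /allP h; case: ne; apply/mnmP => i.
  by apply/esym/eqP/h; rewrite mem_enum.
have := q0 (enum 'I_n) (fun _ => 1).
rewrite qX mevalZ mevalX big1 ?mulr1 // => i _; by rewrite expr1n.
Qed.

Lemma mwt_mdeg m : mwt (fun _ => 1%N) m = mdeg m.
Proof. by rewrite mdegE; apply: eq_bigr => i _; rewrite muln1. Qed.

Lemma pihomog_mdeg d (p : {mpoly K[n]}) :
  pihomog mdeg d p = pihomog (mwt (fun _ => 1%N)) d p.
Proof. by apply/mpolyP => m; rewrite !mcoeff_pihomog /= mwt_mdeg. Qed.

Lemma pihomog_sum (mf : measure n) (p : {mpoly K[n]}) :
  exists D, p = \sum_(d < D) pihomog mf d p.
Proof. by exists (mmeasure mf p); apply: pihomog_partitionE. Qed.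

Lemma dhomog_meval d (p : {mpoly K[n]}) s x : p \is d.-homog ->
  p.@[fun i => s * x i] = s ^+ d * p.@[x].
Proof.
move/dhomogP => hp; rewrite !mevalE mulr_sumr !big_seq; apply: eq_bigr => m mp.
rewrite -(hp m mp) /= mdegE mulrCA expr_sum -big_split /=; congr (_ * _).
by apply: eq_bigr => i _; rewrite exprMn.
Qed.

End WeightedLines.

Section AlgebraicDependence.
Variable (K : numFieldType).

Lemma msize_prod (n : nat) (I : Type) (r : seq I) (F : I -> {mpoly K[n]}) B :
  (forall i, (msize (F i)).-1 <= B)%N ->
  ((msize (\prod_(i <- r) F i)).-1 <= size r * B)%N.
Proof.
move=> h; elim: r => [|i r IH]; first by rewrite big_nil msize1.
rewrite big_cons /= mulSn.
have [->|nz1] := eqVneq (F i) 0; first by rewrite mul0r msize0.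
have [->|nz2] := eqVneq (\prod_(j <- r) F j) 0; first by rewrite mulr0 msize0.
rewrite msizeM //; apply: leq_trans (leq_add (h i) IH).
by move: (mpolySpred mdeg nz1) (mpolySpred mdeg nz2) => /= -> ->; rewrite addSn addnS.
Qed.


Lemma size_index_enum_ord n : size (index_enum 'I_n) = n.
Proof. by rewrite -[RHS]card_ord cardT enumT. Qed.

Lemma msizeXn_le (n : nat) (q : {mpoly K[n]}) a B :
  ((msize q).-1 <= B)%N -> ((msize (q ^+ a)).-1 <= a * B)%N.
Proof.
move=> qB; rewrite -[a in q ^+ a]card_ord -prodr_const.
by have := @msize_prod n _ (index_enum 'I_a) (fun=> q) B (fun=> qB);
  rewrite size_index_enum_ord.
Qed.

Lemma exists_left_kernel (a b : nat) (A : 'M[K]_(a, b)) : (b < a)%N ->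
  exists2 u : 'rV_a, u != 0 & u *m A = 0.
Proof.
move=> ba; have : kermx A != 0.
  by rewrite -mxrank_eq0 mxrank_ker subn_eq0 -ltnNge (leq_ltn_trans (rank_leq_col A)).
by case/rowV0Pn => u /sub_kermxP uA u0; exists u.
Qed.

(** Count monomials: with exponents below N there are N^(m+1) products of
    powers of the p i, whose own exponents stay below B = c N, where c is
    independent of N. They lie in a space of dimension (c N)^m, which is
    smaller once N exceeds c^m. *)
Theorem algebraic_dependence (m : nat) (p : 'I_m.+1 -> {mpoly K[m]}) :
  exists2 Q : {mpoly K[m.+1]}, Q != 0 &
    forall x, Q.@[fun i => (p i).@[x]] = 0.
Proof.
pose e := (\max_i (msize (p i)).-1)%N.
(* a product of N-1-st powers has degree at most (m+1) e (N-1), hence below c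
   N *)
pose c := (m.+1 * e).+1%N.
pose N := (c ^ m).+1%N.
pose B := (c * N)%N.
pose I := {ffun 'I_m.+1 -> 'I_N}; pose J := {ffun 'I_m -> 'I_B}.
pose al (a : 'I_#|I|) : 'X_{1..m.+1} := [multinom (enum_val a i : nat) | i < m.+1].
pose be (b : 'I_#|J|) : 'X_{1..m} := [multinom (enum_val b i : nat) | i < m].
pose P a := \prod_i p i ^+ al a i.
have [u u0 uA] : exists2 u : 'rV_#|I|, u != 0 &
    u *m (\matrix_(a, b) (P a)@_(be b) : 'M_(#|I|, #|J|)) = 0.
  apply: exists_left_kernel; rewrite !card_ffun !card_ord /B expnMn expnS.
  by rewrite ltn_pmul2r ?expn_gt0.
have al_inj : injective al.
  move=> a a' /mnmP eqa; apply/enum_val_inj/ffunP => i; apply/val_inj.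
  by have := eqa i; rewrite !mnmE.
exists (\sum_a u 0 a *: 'X_[al a]).
  apply: contraNneq u0 => Q0; apply/eqP/rowP => a; rewrite mxE.
  have := congr1 (mcoeff (al a)) Q0; rewrite raddf_sum mcoeff0 /= (bigD1 a) //=.
  rewrite mcoeffZ mcoeffX eqxx mulr1 big1 ?addr0 // => a' ne.
  by rewrite mcoeffZ mcoeffX (inj_eq al_inj) (negPf ne) mulr0.
move=> x; rewrite raddf_sum /=.
suff PZ : \sum_a u 0 a *: P a = 0.
  have := congr1 (meval x) PZ; rewrite raddf_sum meval0 /= => PZx.
  rewrite -[RHS]PZx; apply: eq_bigr => a _; rewrite !mevalZ mevalX rmorph_prod /=.
  by congr (_ * _); apply: eq_bigr => i _; rewrite rmorphXn.
(* the kernel vector kills the coefficients in the box; outside the box the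
   products have none, for degree reasons *)
apply/mpolyP => mm; rewrite mcoeff0 raddf_sum /=.
case: (boolP [forall i, mm i < B]%N) => [/forallP mB|].
  pose b := enum_rank [ffun i => Ordinal (mB i)].
  have -> : mm = be b.
    by apply/mnmP => i; rewrite mnmE enum_rankK ffunE.
  have /rowP/(_ b) := uA; rewrite !mxE => uAb; rewrite -[RHS]uAb.
  by apply: eq_bigr => a _; rewrite mcoeffZ mxE.
rewrite negb_forall => /existsP[i0]; rewrite -leqNgt => mB.
apply: big1 => a _; rewrite mcoeffZ memN_msupp_eq0 ?mulr0 //.
apply/negP => /msize_mdeg_lt; apply/negP; rewrite -leqNgt.
have mdegB : (B <= mdeg mm)%N.
  by rewrite mdegE (bigD1 i0) //= (leq_trans mB) ?leq_addr.
apply: leq_trans mdegB; rewrite /P.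
have : ((msize (P a)).-1 <= m.+1 * (N * e))%N.
  rewrite -[m.+1]size_index_enum_ord; apply: msize_prod => i.
  have pe : ((msize (p i)).-1 <= e)%N by exact: (leq_bigmax i).
  apply: leq_trans (msizeXn_le _ pe) _.
  by rewrite leq_mul2r mnmE ltnW ?orbT.
rewrite /P /B /c; set s := msize _.
rewrite -ltnS => /(leq_trans (leqSpred _)) /leq_trans; apply.
by rewrite -addn1 addnC [leqRHS]mulSn leq_add // [(N * e)%N]mulnC mulnA.
Qed.

End AlgebraicDependence.

(** * Ideals of cones with few generators *)

(** Over the fraction field B has rank b >= a, so its rows are independent;
    the inequality a <= b is what excludes superfluous generators. *)
Lemma left_regular_of_det (A : idomainType) (a b : nat) (G : 'M[A]_(b, a))
    (B : 'M[A]_(a, b)) (u : 'rV[A]_a) :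
  (a <= b)%N -> \det (G *m B) != 0 -> u *m B = 0 -> u = 0.
Proof.
move=> ab dGB uB; pose t k l (X : 'M[A]_(k, l)) := map_mx (@tofrac A) X.
have rB : row_free (t _ _ B).
  rewrite /row_free eqn_leq rank_leq_row (leq_trans ab) //.
  apply: leq_trans (mxrankM_maxr (t _ _ G) _).
  rewrite -map_mxM mxrank_unit // unitmxE unitfE det_map_mx tofrac_eq0.
  exact: dGB.
have : t _ _ u *m t _ _ B == 0 by rewrite -map_mxM uB map_mx0.
rewrite mulmx_free_eq0 // => /eqP/matrixP tu; apply/matrixP => i j.
by apply/eqP; have := tu i j; rewrite !mxE -tofrac_eq0 => ->.
Qed.

Section FewGenerators.
Variables (K : numFieldType) (M : nat).
Implicit Types (p q : {mpoly K[M]}) (S : ('I_M -> K) -> Prop).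

Definition vanishing S p := forall x, S x -> p.@[x] = 0.

Definition generates (J : {mpoly K[M]} -> Prop) c (f : 'I_c -> {mpoly K[M]}) :=
  forall p, J p <-> exists g : 'I_c -> {mpoly K[M]}, p = \sum_(i < c) g i * f i.

(** The point with i-th coordinate (i == i0) spans the i0-th axis; this is
    restriction to that axis, with coordinate 'X. *)
Definition on_axis (i0 : 'I_M) : {mpoly K[M]} -> {poly K} :=
  wline (fun _ => 1%N) (fun i => (i == i0)%:R).

HB.instance Definition _ i0 := GRing.RMorphism.on (on_axis i0).

(** For p in an ideal that vanishes on the axis these are the components of
    the differential of p along the axis. On the ideal this map is linear over
    the restrictions of the coefficients to the axis. *)
Definition conormal (i0 j : 'I_M) p : {poly K} := on_axis i0 p^`M(j).

Lemma vanishing_pihomog_mdeg S p d :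
  (forall s x, S x -> S (fun i => s * x i)) ->
  vanishing S p -> vanishing S (pihomog mdeg d p).
Proof.
move=> Ss Sp x Sx; rewrite pihomog_mdeg; apply: pihomog_vanish => s.
by apply: Sp; apply: Ss.
Qed.

Lemma vanishing_pihomog_mwt S (wt : 'I_M -> nat) p d :
  (forall s x, S x -> S (fun i => s ^+ wt i * x i)) ->
  vanishing S p -> vanishing S (pihomog (mwt wt) d p).
Proof.
by move=> Ss Sp x Sx; apply: pihomog_vanish => s; apply: Sp; apply: Ss.
Qed.

Lemma dhomog_pihomog (mf1 mf2 : measure M) d k p :
  p \is d.-homog for mf1 -> pihomog mf2 k p \is d.-homog for mf1.
Proof.
move/dhomogP => hp; apply/dhomogP => m.
rewrite mcoeff_msupp mcoeff_pihomog; case: ifP => _; rewrite ?eqxx //.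
by rewrite -mcoeff_msupp; apply: hp.
Qed.

Lemma dhomog1E q : q \is 1.-homog -> q = \sum_i q@_U_(i) *: 'X_i.
Proof.
move/dhomogP => hq; apply/mpolyP => m; rewrite raddf_sum /=.
under eq_bigr do rewrite mcoeffZ mcoeffX.
case: (boolP (mdeg m == 1%N)) => [/mdeg1P[i /eqP ->]|m1].
  rewrite (bigD1 i) //= eqxx mulr1 big1 ?addr0 // => j ne.
  by rewrite eq_mnm1 (negPf ne) mulr0.
rewrite memN_msupp_eq0; last by apply: contra m1 => /hq ->.
rewrite big1 // => j _; case: eqP => [e|_]; last by rewrite mulr0.
by rewrite -e mdeg1 in m1.
Qed.

(** Here S is the set of points of the cone and r bounds the weights. The
    hypotheses say in turn that S is stable under scaling and under the
    weighted scaling, contains the axis of a coordinate of weight 0 and spans,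
    and that the conormal vectors of the ideal have full rank in the
    coordinates of weight at least 2. The number of these coordinates is the
    codimension. *)
Theorem few_generators_vanish S (wt : 'I_M -> nat) (r : nat) (i0 : 'I_M)
    (c : nat) (f : 'I_c -> {mpoly K[M]}) :
  (forall s x, S x -> S (fun i => s * x i)) ->
  (forall s x, S x -> S (fun i => s ^+ wt i * x i)) ->
  S (fun i => (i == i0)%:R) ->
  wt i0 = 0%N -> (forall i, wt i <= r)%N ->
  (forall a : 'I_M -> K, (forall x, S x -> \sum_i a i * x i = 0) ->
     forall i, a i = 0) ->
  (forall i, (2 <= wt i)%N -> exists2 h, vanishing S h &
     exists2 u, u != 0 & forall j, (2 <= wt j)%N ->
       conormal i0 j h = if i == j then u else 0) ->
  generates (vanishing S) f -> (c <= #|[set i | 2 <= wt i]%N|)%N ->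
  forall p l, vanishing S p -> (forall i, ((wt i).*2 <= r)%N -> l i = 0) ->
    p.@[l] = 0.
Proof.
move=> Ss Sw S0 wt0 wtr Sfree Sh gen cN p l Sp l0.
have f_van i : vanishing S (f i).
  apply/gen; exists (fun j => (j == i)%:R).
  rewrite (bigD1 i) //= eqxx mul1r big1 ?addr0 // => j /negPf ->.
  by rewrite mul0r.
have axis_van q : vanishing S q -> on_axis i0 q = 0.
  move=> Sq; apply: poly_eq0_fun => s _; rewrite horner_wline.
  by apply: Sq; apply: (Ss).
have conM g q j : vanishing S q ->
    conormal i0 j (g * q) = on_axis i0 g * conormal i0 j q.
  by move=> Sq; rewrite /conormal mderivM rmorphD !rmorphM /= (axis_van q Sq) mulr0 add0r.
have con_sum (g : 'I_c -> {mpoly K[M]}) j :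
    conormal i0 j (\sum_i g i * f i) = \sum_i on_axis i0 (g i) * conormal i0 j (f i).
  rewrite /conormal (raddf_sum (mderiv j)) rmorph_sum /=; apply: eq_bigr => i _.
  exact: conM.
pose Y := [set i | 2 <= wt i]%N.
have Yi (j : 'I_#|Y|) : (2 <= wt (enum_val j))%N.
  by have := enum_valP j; rewrite inE.
(* the conormal vectors of the generators are independent: multiplied by the
   matrix of coefficients of the elements h they give a diagonal matrix with
   non-zero entries *)
have con_free (g : 'I_c -> {mpoly K[M]}) :
    (forall j, (2 <= wt j)%N -> conormal i0 j (\sum_i g i * f i) = 0) ->
    forall i, on_axis i0 (g i) = 0.
  move=> g0.
  pose B := \matrix_(i < c, j < #|Y|) conormal i0 (enum_val j) (f i).
  have Gex (j : 'I_#|Y|) : exists gu : ('I_c -> {mpoly K[M]}) * {poly K},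
     gu.2 != 0 /\ forall j', conormal i0 (enum_val j') (\sum_i gu.1 i * f i)
       = if j == j' then gu.2 else 0.
    have [h Sh1 [u u0 hu]] := Sh _ (Yi j).
    have /gen[gh hE] := Sh1; exists (gh, u); split => // j' /=.
    by rewrite -hE hu // (inj_eq enum_val_inj).
  have [gu guP] := @fin_all_exists _ _ _ Gex.
  pose G := \matrix_(j < #|Y|, i < c) on_axis i0 ((gu j).1 i).
  have GB : G *m B = diag_mx (\row_j (gu j).2).
    apply/matrixP => j j'; rewrite !mxE.
    under eq_bigr do rewrite !mxE.
    rewrite -con_sum (guP j).2; case: eqP => [->|_]; by rewrite ?mulr1n ?mulr0n.
  have dGB : \det (G *m B) != 0.
    rewrite GB det_diag; apply/prodf_neq0 => j _; rewrite mxE.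
    exact: (guP j).1.
  have uB : (\row_i on_axis i0 (g i)) *m B = 0.
    apply/rowP => j; rewrite !mxE; under eq_bigr do rewrite !mxE.
    by rewrite -con_sum g0.
  move=> i; have /rowP/(_ i) := left_regular_of_det cN dGB uB.
  by rewrite !mxE.
have van_homog : forall d q, vanishing S q -> q \is d.-homog -> q.@[l] = 0.
  elim/ltn_ind => d IH q1 Sq1 hq1.
  have [D ->] := pihomog_sum (mwt wt) q1; rewrite raddf_sum big1 // => k _ /=.
  move: (nat_of_ord k) => {}k; set q := pihomog _ _ _.
  have Sq : vanishing S q by apply: vanishing_pihomog_mwt.
  have hq : q \is d.-homog by apply: dhomog_pihomog.
  have hk : q \is k.-homog for (mwt wt) by apply: pihomogP.
  (* small weight: L already kills every monomial *)
  case: (leqP k r) => kr.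
    case: d IH hq1 hq => [|[|d]] _ _ hq.
    + have q0 x : q.@[fun=> 0] = q.@[x].
        have := dhomog_meval 0 x hq; rewrite mul1r => <-.
        by apply: meval_eq => i; rewrite mul0r.
      by rewrite /= -(q0 l) (q0 (fun i => (i == i0)%:R)) (Sq _ S0).
    + rewrite (dhomog1E hq) raddf_sum big1 // => i _ /=.
      rewrite mevalZ (Sfree (fun i => q@_U_(i))) ?mul0r // => x Sx.
      rewrite -[RHS](Sq _ Sx) [in RHS](dhomog1E hq) raddf_sum.
      by apply: eq_bigr => j _; rewrite /= mevalZ mevalXU.
    rewrite mevalE big_seq big1 // => m mq.
    suff /existsP[i /andP[mi wi]] : [exists i, (m i != 0) && ((wt i).*2 <= r)]%N.
      by rewrite (bigD1 i) //= l0 // expr0n (negPf mi) mul0r mulr0.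
    apply: contraT; rewrite negb_exists => /forallP big_wt.
    have degm := dhomog_mf hq mq; have wtm := dhomog_mf hk mq.
    (* if all variables of m had 2 wt > r, then m would have weight k with 2 k
       >= d (r+1), although k <= r and d >= 2 *)
    suff : (mdeg m * r.+1 <= k.*2)%N.
      rewrite degm; move: kr; clear; nia.
    rewrite -wtm /= mdegE /mwt -muln2 !big_distrl /=; apply: leq_sum => i _.
    have := big_wt i; rewrite negb_and negbK -ltnNge => /orP[/eqP ->//|ri].
    by rewrite -mulnA leq_mul2l muln2 ri orbT.
  have [g qE] := (gen q).1 Sq.
  (* large weight: only monomials x_0^a x_j could contribute, and they have
     weight at most r *)
  have con0 j : (2 <= wt j)%N -> conormal i0 j q = 0.
    move=> _; rewrite /conormal /on_axis wlineE big_seq big1 // => m mq.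
    case: (boolP [exists i, (i != i0) && (m i != 0%N)]) => [/existsP[i /andP[ii mi]]|].
      by rewrite (bigD1 i) //= (negPf ii) expr0n (negPf mi) mul0r mulr0 scale0r.
    rewrite negb_exists => /forallP hm.
    rewrite mcoeff_mderiv (dhomog_nemf_coeff hk) ?mul0rn ?mul0r ?scale0r //=.
    rewrite mwtD [mwt wt m]big1 ?add0n => [|i _].
      rewrite /mwt (bigD1 j) //= mnm1E eqxx mul1n big1 => [|i /negPf ij].
        by rewrite addn0 neq_ltn (leq_ltn_trans (wtr j) kr).
      by rewrite mnm1E eq_sym ij.
    have := hm i; rewrite negb_and !negbK => /orP[/eqP->|/eqP->//].
    by rewrite wt0 muln0.
  rewrite qE in con0; have g0 := con_free _ con0.
  (* the coefficients have no constant term, so along the line through l the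
     generators enter with degree below d *)
  have gl0 i : (wline (fun _ => 1%N) l (g i))`_0 = 0.
    rewrite -horner_coef0 horner_wline.
    have := congr1 (horner^~ 0) (g0 i); rewrite /on_axis horner_wline horner0 => E.
    rewrite -[RHS]E.
    by apply: meval_eq => j; rewrite !mul0r.
  rewrite -(pihomog_dE hq) pihomog_mdeg -coef_wline qE rmorph_sum coef_sum big1 // => i _.
  rewrite rmorphM coefM big1 // => [[[|a] ad] _] /=; first by rewrite gl0 mul0r.
  rewrite [X in _ * X]coef_wline -pihomog_mdeg (IH (d - a.+1)%N) ?mulr0 //.
  - by rewrite ltn_subrL; case: (d) ad.
  - exact: vanishing_pihomog_mdeg.
  - exact: pihomogP.
have [D ->] := pihomog_sum mdeg p; rewrite raddf_sum big1 // => d _.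
by apply: (van_homog d); [apply: vanishing_pihomog_mdeg | apply: pihomogP].
Qed.
End FewGenerators.

(** * Symmetric forms *)

Section Forms.
Variables (R : realType) (W : vectType R[i]).
Local Notation mform := (mform W).
Implicit Types (w u : W).

Lemma mdiagS k w (phi : mform k.+1) :
  mdiag w phi = mdiag w (iota_form w phi).
Proof. by []. Qed.

Lemma iota_formD k w u (phi : mform k.+1) :
  iota_form (w + u) phi = iota_form w phi + iota_form u phi.
Proof. exact: linearD. Qed.

Lemma iota_formZ k s w (phi : mform k.+1) :
  iota_form (s *: w) phi = s *: iota_form w phi.
Proof. exact: linearZ. Qed.

Lemma mdiagZ k s w (phi : mform k) : mdiag (s *: w) phi = s ^+ k * mdiag w phi.
Proof.
elim: k phi => [|k IH] phi; first by rewrite mul1r.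
by rewrite mdiagS iota_formZ linearZ /= IH exprS -mulrA.
Qed.

Lemma mapply_ext k (phi : mform k) (f g : 'I_k -> W) :
  f =1 g -> mapply phi f = mapply phi g.
Proof.
elim: k phi f g => //= k IH phi f g fg.
by rewrite fg; apply: IH => i; apply: fg.
Qed.

(** Curried forms are determined by their values, so the symmetry of a form
    passes from its values to identities between contractions. *)
Lemma mform_ext k (phi psi : mform k) :
  (forall f, mapply phi f = mapply psi f) -> phi = psi.
Proof.
elim: k phi psi => [|k IH] phi psi h; first exact: (h (fun=> 0)).
apply/lfunP => w; apply: IH => f.
pose g (i : 'I_k.+1) := oapp f w (unlift ord0 i).
have gE (chi : mform k.+1) : mapply chi g = mapply (iota_form w chi) f.
  by rewrite /= {1}/g unlift_none; apply: mapply_ext => i; rewrite /g liftK.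
by rewrite -!(gE _); apply: h.
Qed.

Lemma symform_iota k w (phi : mform k.+1) :
  symform phi -> symform (iota_form w phi).
Proof.
move=> sphi s f.
pose g (i : 'I_k.+1) := oapp f w (unlift ord0 i).
have := sphi (lift_perm ord0 ord0 s) g => /=.
rewrite lift_perm_id {1 3}/g unlift_none /= => h.
transitivity (mapply (iota_form w phi)
    (fun i => g (lift_perm ord0 ord0 s (lift ord0 i)))).
  by apply: mapply_ext => i; rewrite lift_perm_lift /g liftK.
by rewrite h; apply: mapply_ext => i; rewrite /g liftK.
Qed.

Lemma symform_iotaC k w u (phi : mform k.+2) :
  symform phi -> iota_form u (iota_form w phi) = iota_form w (iota_form u phi).
Proof.
move=> sphi; apply: mform_ext => f.
pose g a b (i : 'I_k.+2) :=
  oapp (fun j => oapp f b (unlift ord0 j)) a (unlift ord0 i).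
have gE a b : mapply phi (g a b) = mapply (iota_form b (iota_form a phi)) f.
  rewrite /= {1 2}/g unlift_none liftK /= unlift_none /=.
  by apply: mapply_ext => i; rewrite /g !liftK /= liftK.
rewrite -!gE -(sphi (tperm ord0 (lift ord0 ord0))); apply: mapply_ext => i.
case: (unliftP ord0 i) => [j ->|->]; last first.
  by rewrite tpermL /g liftK /= !unlift_none.
case: (unliftP ord0 j) => [j' ->|->]; last first.
  by rewrite tpermR /g liftK /= !unlift_none.
by rewrite tpermD // /g !liftK /= !liftK.
Qed.

Fixpoint line_poly w u k : mform k -> {poly R[i]} :=
  match k return mform k -> {poly R[i]} with
  | 0 => fun c => (c : R[i])%:P
  | k'.+1 => fun phi : mform k'.+1 =>
      line_poly w u (iota_form w phi) + line_poly w u (iota_form u phi) * 'X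
  end.

Lemma horner_line_poly w u k (phi : mform k) s :
  (line_poly w u phi).[s] = mdiag (w + s *: u) phi.
Proof.
elim: k phi => [|k IH] phi /=; first by rewrite hornerC.
rewrite hornerD hornerMX !IH mdiagS iota_formD iota_formZ linearD linearZ /=.
by congr (_ + _); exact: mulrC.
Qed.

Lemma coef0_line_poly w u k (phi : mform k) : (line_poly w u phi)`_0 = mdiag w phi.
Proof. by rewrite -horner_coef0 horner_line_poly scale0r addr0. Qed.

Lemma coef1_line_poly w u k (phi : mform k.+1) : symform phi ->
  (line_poly w u phi)`_1 = k.+1%:R * mdiag w (iota_form u phi).
Proof.
elim: k phi => [|k IH] phi sphi.
  by rewrite /= coefD coefMX !coefC /= add0r mul1r.
have -> : (line_poly w u phi)`_1 =
    (line_poly w u (iota_form w phi))`_1 + (line_poly w u (iota_form u phi))`_0.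
  by rewrite [line_poly w u phi]/= coefD coefMX.
rewrite IH; last exact: symform_iota.
rewrite symform_iotaC // -mdiagS coef0_line_poly -[in RHS]addn1 natrD mulrDl.
by rewrite mul1r.
Qed.

(** The derivative of phi(w, ..., w) in the direction u is k phi(u, w, ...,
    w), so in characteristic 0 every contraction has zero diagonal as well,
    and induction on the number of arguments applies. *)
Lemma polarization k (phi : mform k) :
  symform phi -> (forall w, mdiag w phi = 0) -> phi = 0.
Proof.
elim: k phi => [|k IH] phi sphi phi0; first exact: (phi0 0).
apply/lfunP => u; rewrite lfunE /=; apply: IH; first exact: symform_iota.
move=> w; have := coef1_line_poly w u sphi.
rewrite (_ : line_poly _ _ _ = 0).
  by rewrite coef0 => /esym/eqP; rewrite mulf_eq0 pnatr_eq0 => /eqP.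
by apply: poly_eq0_fun => s _; rewrite horner_line_poly phi0.
Qed.

Section PolyForm.
Variables (n M : nat) (e : 'I_n -> W) (Y : 'I_n -> {mpoly R[i][M]}).

(** The polynomial function phi(x, ..., x) for x = sum_a Y_a e_a, where the
    Y_a may be any polynomials: variables for the relation between phi and its
    derivatives, linear forms of weight 1 for the equations of the graph. *)
Fixpoint polyform k : mform k -> {mpoly R[i][M]} :=
  match k return mform k -> {mpoly R[i][M]} with
  | 0 => fun c => (c : R[i])%:MP
  | k'.+1 => fun phi : mform k'.+1 =>
      \sum_a Y a * polyform (iota_form (e a) phi)
  end.

Lemma meval_polyform k (phi : mform k) x :
  (polyform phi).@[x] = mdiag (\sum_a (Y a).@[x] *: e a) phi.
Proof.
elim: k phi => [|k IH] phi /=; first by rewrite mevalC.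
rewrite mdiagS {2}/iota_form linear_sum linear_sum raddf_sum /=.
by apply: eq_bigr => a _; rewrite mevalM IH linearZ linearZ.
Qed.

Lemma mderiv_polyform k (phi : mform k) j :
  (forall a, (Y a)^`M(j) = 0) -> (polyform phi)^`M(j) = 0.
Proof.
move=> Y0; elim: k phi => [|k IH] phi /=; first by rewrite mderivC.
rewrite (raddf_sum (mderiv j)) big1 // => a _ /=.
by rewrite mderivM Y0 IH mul0r mulr0 addr0.
Qed.
End PolyForm.
End Forms.

(** * The components of a vector of V_F *)

(** Needed because the spaces of k-linear forms have different types for
    different k, so a family indexed by k cannot be given by a plain
    conditional. *)
Lemma dependent_update (U : nat -> Type) (d : forall k, U k) k0 (x : U k0) :
  exists d' : forall k, U k, d' k0 = x /\ forall k, k != k0 -> d' k = d k.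
Proof.
exists (fun k => match k0 =P k with ReflectT e => ecast k (U k) e x | _ => d k end).
split=> [|k]; first by case: eqP => // e; rewrite eq_axiomK.
by case: eqP => // e /negP[]; rewrite e.
Qed.

Section Coordinates.
Variables (R : realType) (W : vectType R[i]).
Variables (F : forall k, {vspace mform W k}).
Local Notation C := R[i].
Local Notation mform := (mform W).
Local Notation FD k := (dual (subvs_of (F k))).

(** V_F is nested to the left, but its first stage C (+) W departs from the
    pattern of the later ones: W stands in the place of the dual of F^1. These
    two projections hide the difference, by letting w in W act on F^1 by
    evaluation. *)
Definition VF_init r : VF F r.+1 -> VF F r :=
  match r with 0 => fst | _.+1 => fst end.

Lemma VF_init_is_linear r : linear (@VF_init r).
Proof. by case: r. Qed.

HB.instance Definition _ r :=
  GRing.isLinear.Build C (VF F r.+1) (VF F r) _ (@VF_init r) (@VF_init_is_linear r).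

Definition VF_top r : VF F r.+1 -> FD r.+1 :=
  match r return VF F r.+1 -> FD r.+1 with
  | 0 => fun v => iota_pow F 1 v.2
  | _.+1 => snd
  end.

Lemma VF_top_is_linear r : linear (@VF_top r).
Proof.
case: r => [|r] a u v //=; apply/lfunP => phi.
rewrite add_lfunE scale_lfunE !lfunE.
rewrite [LHS]/= [X in _ = _ *: X + _]/= [X in _ = _ + X]/= !mdiagS.
by rewrite iota_formD iota_formZ linearD linearZ.
Qed.

HB.instance Definition _ r :=
  GRing.isLinear.Build C (VF F r.+1) (FD r.+1) _ (@VF_top r) (@VF_top_is_linear r).

Lemma VF_init_phi d r t w :
  VF_init (phi_components F d r.+1 t w) = phi_components F d r t w.
Proof. by case: r. Qed.

Lemma VF_top_phi d r t w :
  VF_top (phi_components F d r.+1 t w) = t ^+ (d - r.+1) *: iota_pow F r.+1 w.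
Proof.
case: r => [|r] //=; apply/lfunP => phi.
by rewrite scale_lfunE !lfunE [LHS]/= mdiagZ expr1 subn1.
Qed.

(** The component of a vector in the dual of F^k for all k at once; here C and
    W are identified with the duals of F^0 and F^1. *)
Fixpoint VF_comp r : VF F r -> forall k, FD k :=
  match r return VF F r -> forall k, FD k with
  | 0 => fun z k =>
      match k return FD k with
      | 0 => (z : C) *: linfun (vsval : subvs_of (F 0) -> C^o)
      | _ => 0
      end
  | r'.+1 => fun v k =>
      match r'.+1 =P k with
      | ReflectT e => ecast k (FD k) e (VF_top v)
      | _ => VF_comp (VF_init v) k
      end
  end.

Lemma VF_comp_top r (v : VF F r.+1) : VF_comp v r.+1 = VF_top v.
Proof. by rewrite /=; case: eqP => // e; rewrite eq_axiomK. Qed.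

Lemma VF_comp_init r (v : VF F r.+1) k : k != r.+1 ->
  VF_comp v k = VF_comp (VF_init v) k.
Proof. by rewrite /=; case: eqP => // e /negP[]; rewrite e. Qed.

Lemma VF_comp_is_linear r k : linear (fun v : VF F r => VF_comp v k).
Proof.
elim: r => [|r IH] a u v.
  case: k => [|k] /=; first by rewrite scalerDl scalerA.
  by rewrite scaler0 addr0.
have [->|ne] := eqVneq k r.+1; first by rewrite !VF_comp_top linearP.
by rewrite !(VF_comp_init _ ne) linearP IH.
Qed.

Lemma VF_comp_phi d r t w k : (k <= r)%N ->
  VF_comp (phi_components F d r t w) k = t ^+ (d - k) *: iota_pow F k w.
Proof.
elim: r => [|r IH] kr.
  move: kr; rewrite leqn0 => /eqP-> /=; rewrite subn0; apply/lfunP => phi.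
  by rewrite !scale_lfunE !lfunE.
have [->|ne] := eqVneq k r.+1; first by rewrite VF_comp_top VF_top_phi.
by rewrite VF_comp_init // VF_init_phi IH // -ltnS ltn_neqAle ne.
Qed.

Hypothesis F0 : F 0 = fullv.
Hypothesis F1 : F 1 = fullv.

Lemma vsval_surj k (phi : mform k) : phi \in F k ->
  exists psi : subvs_of (F k), vsval psi = phi.
Proof. by exists (vsproj (F k) phi); rewrite vsprojK. Qed.

(** This is where F^0 = C and F^1 = W^* are used: F^0 contains 1 and F^1
    separates the points of W. *)
Lemma VF_comp_eq0 r (v : VF F r) :
  (forall k, (k <= r)%N -> VF_comp v k = 0) -> v = 0.
Proof.
elim: r v => [|r IH] v v0.
  have /lfunP := v0 0%N isT.
  have [|one oneE] := @vsval_surj 0%N (1 : C^o); first by rewrite F0 memvf.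
  by move/(_ one); rewrite /= !lfunE /= lfunE /= oneE; rewrite /GRing.scale /= mulr1.
have i0 : VF_init v = 0.
  apply: IH => k kr; rewrite -VF_comp_init ?v0 ?leqW //.
  by rewrite neq_ltn ltnS kr.
have t0 : VF_top v = 0 by rewrite -VF_comp_top v0.
case: r {IH v0} v i0 t0 => [|r] [v1 v2] /= -> t0; last by rewrite t0.
suff -> : v2 = 0 by [].
apply/eqP; rewrite (coord_vbasis (memvf v2)); apply/eqP; apply: big1 => j _.
have [|psi psiE] := @vsval_surj 1%N (linfun (coord (vbasis {:W}) j : W -> C^o)).
  by rewrite F1 memvf.
have : mdiag v2 (vsval psi) = 0.
  by rewrite -iota_powE (t0 : iota_pow F 1 v2 = 0) zero_lfunE.
rewrite psiE mdiagS /iota_form lfunE => cj.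
by rewrite (cj : coord _ j v2 = 0) scale0r.
Qed.
End Coordinates.

(** * Coordinates adapted to the symbol system *)

Section AdaptedBasis.
Variables (R : realType) (W : vectType R[i]).
Variables (F : forall k, {vspace mform W k}) (r : nat).
Local Notation C := R[i].
Local Notation mform := (mform W).

Definition coord_index := {k : 'I_r.+1 & 'I_(\dim (F k))}.
Local Notation T := coord_index.
Local Notation M := #|{: coord_index}|.
Local Notation ix k j := (existT (fun l : 'I_r.+1 => 'I_(\dim (F l))) k j).

Definition basis_form (tau : T) : mform (tag tau) :=
  (vbasis (F (tag tau)))`_(tagged tau).

Definition coord_weight (i : 'I_M) : nat := tag (enum_val i).

Definition diag_coord (w : W) (i : 'I_M) : C := mdiag w (basis_form (enum_val i)).

Lemma basis_form_in tau : basis_form tau \in F (tag tau).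
Proof. by apply/vbasis_mem/mem_nth; rewrite size_tuple. Qed.

Lemma sum_coord_index (A : nmodType) (f : T -> A) :
  \sum_(i < M) f (enum_val i) = \sum_(k < r.+1) \sum_(j < \dim (F k)) f (ix k j).
Proof.
rewrite (reindex_onto enum_rank enum_val) /=; last by move=> i _; rewrite enum_valK.
under eq_bigl do rewrite enum_rankK eqxx.
under eq_bigr do rewrite enum_rankK.
by rewrite sig_big_dep /=; apply: eq_bigr => -[k j].
Qed.

Lemma card_coord_index : M = (\sum_(k < r.+1) \dim (F k))%N.
Proof.
rewrite -[LHS]card_ord -sum1_card.
have := @sum_coord_index nat (fun=> 1%N) => /= ->.
by apply: eq_bigr => k _; rewrite sum_nat_const card_ord muln1.
Qed.

Lemma card_wt_ge2 : (1 <= r)%N ->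
  (#|[set i | 2 <= coord_weight i]| + \dim (F 0) + \dim (F 1))%N = M.
Proof.
move=> r1; rewrite [RHS]card_coord_index -sum1_card.
have -> : (\sum_(i in [set i | 2 <= coord_weight i]) 1 = \sum_(k < r.+1) (2 <= k) * \dim (F k))%N.
  under eq_bigl do rewrite inE.
  rewrite big_mkcond /=.
  have := @sum_coord_index nat (fun tau => if (2 <= tag tau)%N then 1%N else 0%N).
  move=> /= ->; apply: eq_bigr => k _ /=.
  by rewrite sum_nat_const card_ord mulnC; case: (1 < k)%N.
case: (r) r1 => // r' _; rewrite !big_ord_recl /= !mul0n !add0n.
under eq_bigr do rewrite mul1n.
by rewrite addnAC addnC; congr (_ + _)%N; rewrite addnC.
Qed.

Definition linear_form (k : 'I_r.+1) (psi : mform k) : {mpoly C[M]} :=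
  \sum_(j < \dim (F k)) coord (vbasis (F k)) j psi *: 'X_(enum_rank (ix k j)).

(** A point given by one functional on each F^k assigns to the coordinate of
    psi the value of the functional at psi. *)
Lemma meval_linear_form (k : 'I_r.+1) (psi : mform k) (f : forall k, 'Hom(mform k, C^o)) :
  psi \in F k ->
  (linear_form psi).@[fun i => f _ (basis_form (enum_val i))] = f k psi.
Proof.
move=> psiF; rewrite [in RHS](coord_vbasis psiF) linear_sum /linear_form raddf_sum.
apply: eq_bigr => j _ /=; rewrite mevalZ mevalXU linearZ /=.
pose g (tau : T) : C := f _ (basis_form tau).
by rewrite -/(g _) enum_rankK.
Qed.

Lemma mderiv_linear_form (k : 'I_r.+1) (psi : mform k) (i : 'I_M) :
  coord_weight i != k -> (linear_form psi)^`M(i) = 0.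
Proof.
move=> ik; rewrite /linear_form (raddf_sum (mderiv i)) big1 // => j _ /=.
rewrite mderivZ mderivX mnm1E; case: eqP => [e|_]; last by rewrite ?mulr0n ?scale0r scaler0.
by rewrite /coord_weight -e enum_rankK eqxx in ik.
Qed.

Definition to_coords (v : VF F r) : 'rV[C]_M :=
  \row_i (VF_comp v (coord_weight i) : 'Hom(_, _)) (vsproj _ (basis_form (enum_val i))).

Lemma to_coords_is_linear : linear to_coords.
Proof.
move=> a u v; apply/rowP => i; rewrite !mxE VF_comp_is_linear.
by rewrite add_lfunE scale_lfunE.
Qed.

HB.instance Definition _ :=
  GRing.isLinear.Build C (VF F r) 'rV[C]_M _ to_coords to_coords_is_linear.

Lemma to_coords_phi t w i :
  to_coords (phi_map F r t w) 0 i = t ^+ (r - coord_weight i) * diag_coord w i.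
Proof.
rewrite mxE /phi_map VF_comp_phi; last by rewrite /coord_weight -ltnS.
by rewrite scale_lfunE iota_powE vsprojK ?basis_form_in.
Qed.

Hypothesis FS : symbol_system r F.

Lemma dim_VF : \dim {:VF F r} = M.
Proof.
rewrite card_coord_index dimvf; elim: (r) => [|r' IH].
  by rewrite big_ord_recl big_ord0 addn0 (ss_F0 FS) dimvf.
rewrite big_ord_recr /= -IH; case: r' {IH} => [|r'] /=.
  rewrite (ss_F1 FS) dimvf; exact: (congr1 (addn _) (esym (muln1 _))).
exact: (congr1 (addn _) (muln1 _)).
Qed.

Lemma to_coords_inj : injective to_coords.
Proof.
move=> u v; move/eqP; rewrite -subr_eq0 -linearB => /eqP/rowP uv.
apply/eqP; rewrite -subr_eq0; apply/eqP; move: (u - v) uv => {u} {}v v0.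
apply: (VF_comp_eq0 (ss_F0 FS) (ss_F1 FS)) => k kr; apply/lfunP => psi.
rewrite zero_lfunE; have kr' : (k < r.+1)%N by [].
have psiF : vsval psi \in F (Ordinal kr') by exact: subvsP.
rewrite -(vsvalK psi) (coord_vbasis psiF) !linear_sum big1 // => j _.
rewrite !linearZ /=.
have := v0 (enum_rank (ix (Ordinal kr') j)); rewrite !mxE /coord_weight enum_rankK => /= ->.
by rewrite scaler0.
Qed.

(** Injectivity and a dimension count give surjectivity. *)
Lemma of_coords : exists2 g : 'Hom('rV[C]_M, VF F r),
  cancel to_coords g & cancel g to_coords.
Proof.
pose f : 'Hom(VF F r, 'rV[C]_M) := linfun to_coords.
have kf : lker f == 0%VS by apply/lker0P => u v; rewrite !lfunE; apply: to_coords_inj.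
exists (f^-1)%VF => v; first by rewrite -[to_coords v](lfunE to_coords) lker0_lfunK.
rewrite -(lfunE to_coords) limg_lfunVK //.
suff -> : limg f = fullv by apply: memvf.
apply/eqP; rewrite eqEdim subvf /=.
have := limg_ker_dim f fullv; rewrite capfv (eqP kf) dimv0 add0n => ->.
by rewrite dim_VF dimvf /dim /= mul1n.
Qed.
End AdaptedBasis.

(** * The cone over M(F) *)

(** Used to find points at which independent linear coordinates take
    prescribed values. *)
Lemma functional_on_free (K : fieldType) (U : vectType K) n (X : n.-tuple U)
    (eta : 'I_n -> K) :
  free X -> exists f : 'Hom(U, K^o), forall i : 'I_n, f X`_i = eta i.
Proof.
move=> fX; exists (\sum_i eta i *: linfun (coord X i : U -> K^o)) => j.
rewrite sum_lfunE (bigD1 j) //= scale_lfunE lfunE /= coord_free // eqxx.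
rewrite big1 ?addr0; first by rewrite /GRing.scale /= mulr1.
by move=> i ij; rewrite scale_lfunE lfunE /= coord_free // 1?eq_sym (negPf ij) scaler0.
Qed.

Section Homogenization.
Variables (K : numFieldType) (n M : nat).
Variables (Q : {mpoly K[n]}) (x0 : {mpoly K[M]}) (Z : 'I_n -> {mpoly K[M]}).

Definition homogenize : {mpoly K[M]} :=
  \sum_(m <- msupp Q) Q@_m *: (x0 ^+ ((msize Q).-1 - mdeg m) * \prod_i Z i ^+ m i).

Lemma meval_homogenize x : homogenize.@[x] =
  \sum_(m <- msupp Q)
    Q@_m * (x0.@[x] ^+ ((msize Q).-1 - mdeg m) * \prod_i (Z i).@[x] ^+ m i).
Proof.
rewrite raddf_sum; apply: eq_bigr => m _ /=.
rewrite mevalZ mevalM rmorphXn rmorph_prod; congr (_ * (_ * _)).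
by apply: eq_bigr => i _; rewrite rmorphXn.
Qed.

Lemma meval_homogenize_cone x s y :
  x0.@[x] = s -> (forall i, (Z i).@[x] = s * y i) ->
  homogenize.@[x] = s ^+ (msize Q).-1 * Q.@[y].
Proof.
move=> x0s Zs; rewrite meval_homogenize (mevalE y Q) mulr_sumr.
apply: eq_big_seq => m mQ; rewrite [RHS]mulrCA; congr (_ * _).
rewrite x0s; under eq_bigr do rewrite Zs exprMn.
rewrite big_split /= -expr_sum -mdegE mulrA -exprD subnK //.
by rewrite -ltnS (leq_trans (msize_mdeg_lt mQ)) ?leqSpred.
Qed.

(** On the hyperplane x0 = 0 only the monomials of maximal degree survive. *)
Lemma meval_homogenize_infinity x y :
  x0.@[x] = 0 -> (forall i, (Z i).@[x] = y i) ->
  homogenize.@[x] = (pihomog mdeg (msize Q).-1 Q).@[y].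
Proof.
move=> x00 Zy; rewrite meval_homogenize pihomogE raddf_sum [RHS]big_mkcond /=.
apply: eq_big_seq => m mQ; rewrite x00 expr0n subn_eq0.
have mle : (mdeg m <= (msize Q).-1)%N.
  by rewrite -ltnS (leq_trans (msize_mdeg_lt mQ)) ?leqSpred.
rewrite [(mdeg m == _)]eqn_leq mle /=; case: leqP => _.
  by rewrite mul1r mevalZ mevalX; congr (_ * _); apply: eq_bigr => i _; rewrite Zy.
by rewrite mul0r mulr0.
Qed.

Lemma pihomog_top_neq0 : Q != 0 -> pihomog mdeg (msize Q).-1 Q != 0.
Proof.
move=> Q0; apply/negP => /eqP/(congr1 (mcoeff (mlead Q))).
rewrite mcoeff_pihomog mcoeff0 /= -(mlead_deg Q0) eqxx => /eqP.
by rewrite mleadc_eq0 (negPf Q0).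
Qed.
End Homogenization.

(** Expand one argument at a time: symmetry moves an entry z to the front,
    where the form kills it. *)
Lemma mdiag_kernel (R : realType) (W : vectType R[i]) k (phi : mform W k.+1) (u z : W) :
  symform phi -> iota_form z phi = 0 -> mdiag (u + z) phi = mdiag u phi.
Proof.
elim: k phi => [|k IH] phi sphi z0; rewrite mdiagS iota_formD z0 addr0 //.
rewrite IH //; first exact: symform_iota.
by rewrite symform_iotaC // z0; exact: (@zero_lfunE _ W (mform W k) u).
Qed.

Section Cone.
Variables (R : realType) (W : vectType R[i]).
Variables (F : forall k, {vspace mform W k}) (r : nat).
Hypothesis FS : symbol_system r F.
Local Notation C := R[i].
Local Notation mform := (mform W).
Local Notation M := #|{: coord_index F r}|.
Local Notation wt := (@coord_weight R W F r).
Local Notation lf k psi := (@linear_form R W F r k psi).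
Local Notation dcoord := (@diag_coord R W F r).
Local Notation ix k j := (existT (fun l : 'I_r.+1 => 'I_(\dim (F l))) k j).

(** The points with t = 1, scaled. The points with t = 0 are limits of these
    and impose no further conditions on polynomials. *)
Definition cone (x : 'I_M -> C) : Prop :=
  exists s w, forall i, x i = s * dcoord w i.

Lemma diag_coordZ s w i : dcoord (s *: w) i = s ^+ wt i * dcoord w i.
Proof. exact: mdiagZ. Qed.

Lemma cone_scale s x : cone x -> cone (fun i => s * x i).
Proof. by case=> t [w xE]; exists (s * t), w => i; rewrite xE mulrA. Qed.

Lemma cone_weighted s x : cone x -> cone (fun i => s ^+ wt i * x i).
Proof.
by case=> t [w xE]; exists t, (s *: w) => i; rewrite xE diag_coordZ mulrCA.
Qed.

Lemma vanishing_coneP (p : {mpoly C[M]}) :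
  vanishing cone p <-> forall s w, p.@[fun i => s * dcoord w i] = 0.
Proof.
split=> [p0 s w|p0 x [s [w xE]]]; first by apply: p0; exists s, w.
by rewrite (meval_eq _ xE).
Qed.

Lemma meval_linear_form_cone (k : 'I_r.+1) (psi : mform k) s w :
  psi \in F k ->
  (lf k psi).@[fun i => s * dcoord w i] = s * mdiag w psi.
Proof.
move=> psiF.
have := meval_linear_form (fun k => s *: linfun (@mdiag R W k w)) psiF.
rewrite scale_lfunE lfunE => E; rewrite -[RHS]E; apply: meval_eq => i.
by rewrite scale_lfunE lfunE.
Qed.

Definition form_one : mform (@ord0 r) := (1 : C^o).

Lemma form_one_in : form_one \in F (@ord0 r).
Proof. by rewrite [F _](ss_F0 FS) memvf. Qed.

Lemma meval_form_one s w :
  (lf ord0 form_one).@[fun i => s * dcoord w i] = s.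
Proof. by rewrite meval_linear_form_cone ?form_one_in // mulr1. Qed.

(** The cone contains the coordinate axis of x_0, because all forms of
    positive degree vanish at w = 0. The basis vector of F^0 need not be 1,
    whence the scaling factor. *)
Lemma exists_origin : exists i0 : 'I_M,
  wt i0 = 0%N /\ cone (fun i => (i == i0)%:R).
Proof.
have d0 : \dim (F (@ord0 r)) = 1%N by rewrite [F _](ss_F0 FS) dimvf.
have lt0 : (0 < \dim (F (@ord0 r)))%N by rewrite d0.
pose tau0 : coord_index F r := ix ord0 (Ordinal lt0).
pose i0 : 'I_M := enum_rank tau0.
have wt_i0 : wt i0 = 0%N by rewrite /coord_weight enum_rankK.
have wtP i : wt i = 0%N -> i = i0.
  move=> wi; rewrite -(enum_valK i); congr enum_rank; move: wi; rewrite /coord_weight.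
  case: (enum_val i) => k j /= k0.
  have {k0} k0 : k = ord0 by apply: val_inj.
  move: j; rewrite k0 => j; congr existT; apply: val_inj => /=.
  by apply/eqP; rewrite -leqn0 -ltnS; apply: leq_trans (ltn_ord j) _; rewrite d0.
have b0 : dcoord 0 i0 != 0.
  rewrite /diag_coord /i0 enum_rankK.
  have b0 : basis_form tau0 != 0.
    apply: (free_not0 (basis_free (vbasisP (F (@ord0 r))))).
    by apply: mem_nth; rewrite size_tuple.
  exact: b0.
exists i0; split=> //; exists (dcoord 0 i0)^-1, 0 => i.
have [->|ne] := eqVneq i i0; first by rewrite mulVf.
have wn : wt i != 0%N by apply: contra ne => /eqP/wtP->.
have di : dcoord 0 i = 0.
  by rewrite -(scale0r (0 : W)) diag_coordZ expr0n (negPf wn) mul0r.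
by rewrite di mulr0.
Qed.

(** A linear relation between the coordinates splits by weight, as one sees by
    scaling w, into relations between the values phi(w, ..., w) of forms of
    one degree; polarization excludes these. *)
Lemma cone_spans (a : 'I_M -> C) :
  (forall x, cone x -> \sum_i a i * x i = 0) -> forall i, a i = 0.
Proof.
move=> a0.
pose A (tau : coord_index F r) := a (enum_rank tau).
pose Psi (k : 'I_r.+1) : mform k :=
  \sum_(j < \dim (F k)) A (ix k j) *: (basis_form (ix k j) : mform k).
have PsiF k : Psi k \in F k.
  by apply: memv_suml => j _; apply: memvZ; apply: (basis_form_in (ix k j)).
have sumPsi w : \sum_(k < r.+1) mdiag w (Psi k) = 0.
  rewrite -[RHS](a0 (dcoord w)); last by exists 1, w => i; rewrite mul1r.
  transitivity (\sum_(i < M) A (enum_val i) * mdiag w (basis_form (enum_val i))); last first.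
    by apply: eq_bigr => i _; rewrite /A enum_valK.
  rewrite (sum_coord_index (fun tau => A tau * mdiag w (basis_form tau))).
  by apply: eq_bigr => k _; rewrite linear_sum; apply: eq_bigr => j _; rewrite linearZ.
have Psi_diag (k : 'I_r.+1) w : mdiag w (Psi k) = 0.
  (* sum_k s^k Psi_k(w, ..., w) vanishes for all s *)
  pose P : {poly C} := \poly_(l < r.+1) mdiag w (Psi (inord l)).
  have P0 : P = 0.
    apply: poly_eq0_fun => s _; rewrite horner_poly -[RHS](sumPsi (s *: w)).
    by apply: eq_bigr => l _; rewrite mdiagZ mulrC inord_val.
  have := congr1 (fun p : {poly C} => p`_k) P0.
  by rewrite coef_poly ltn_ord coef0 inord_val.
have Psi0 k : Psi k = 0.
  by apply: polarization; [apply: (ss_sym FS (PsiF k)) | apply: Psi_diag].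
move=> i; rewrite -(enum_valK i) -/(A _); case: (enum_val i) => k j.
by have /freeP/(_ (fun j => A (ix k j)) (Psi0 k)) := basis_free (vbasisP (F k)); apply.
Qed.
End Cone.

(** * Equations of the cone *)

Lemma mderivXn0 (K : numFieldType) n (p : {mpoly K[n]}) j k :
  p^`M(j) = 0 -> (p ^+ k)^`M(j) = 0.
Proof.
move=> p0; elim: k => [|k IH]; first by rewrite expr0 -mpolyC1 mderivC.
by rewrite exprS mderivM p0 IH mul0r mulr0 addr0.
Qed.

Section GraphEquations.
Variables (R : realType) (W : vectType R[i]).
Variables (F : forall k, {vspace mform W k}) (r : nat).
Hypothesis FS : symbol_system r F.
Local Notation C := R[i].
Local Notation mform := (mform W).
Local Notation M := #|{: coord_index F r}|.
Local Notation wt := (@coord_weight R W F r).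
Local Notation lf k psi := (@linear_form R W F r k psi).
Local Notation dcoord := (@diag_coord R W F r).
Local Notation ix k j := (existT (fun l : 'I_r.+1 => 'I_(\dim (F l))) k j).
Local Notation cone := (@cone R W F r).

(** Over the point w a coordinate of weight k is a polynomial q of degree k in
    the coordinates of weight 1; homogenised by x_0 this is the equation
    x_0^(k-1) x_i - q. The derivatives of q in the coordinates of weight at
    least 2 are 0. *)
Lemma exists_graph_equation (i0 : 'I_M) (i : 'I_M) :
  wt i0 = 0%N -> cone (fun i => (i == i0)%:R) -> (1 <= r)%N -> (2 <= wt i)%N ->
  exists2 h, vanishing cone h &
    exists2 u, u != 0 & forall j, (2 <= wt j)%N ->
      conormal i0 j h = if i == j then u else 0.
Proof.
move=> wt0 cone0 r1 wi.
have r1' : (1 < r.+1)%N by [].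
pose k1 : 'I_r.+1 := Ordinal r1'.
pose co a : mform k1 := linfun (coord (vbasis {:W}) a : W -> C^o).
have coF a : co a \in F k1 by rewrite [F _](ss_F1 FS) memvf.
pose x0 := lf ord0 (form_one W r).
pose q := polyform (fun a => (vbasis {:W})`_a) (fun a => lf k1 (co a))
            (basis_form (enum_val i)).
exists (x0 ^+ (wt i).-1 * 'X_i - q).
  apply/vanishing_coneP => s w.
  rewrite mevalB mevalM rmorphXn /= mevalXU meval_polyform /x0 (meval_form_one FS).
  have -> : \sum_a (lf k1 (co a)).@[fun i1 => s * dcoord w i1]
      *: (vbasis {:W})`_a = s *: w.
    rewrite [w in RHS](coord_vbasis (memvf w)) scaler_sumr.
    apply: eq_bigr => a _; rewrite meval_linear_form_cone ?coF //.
    by rewrite scalerA mdiagS /iota_form lfunE.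
  by rewrite mdiagZ mulrA -exprSr prednK ?subrr // (ltn_trans _ wi).
have x0d j : (2 <= wt j)%N -> x0^`M(j) = 0.
  by move=> wj; apply: mderiv_linear_form; case: (wt j) wj.
have qd j : (2 <= wt j)%N -> q^`M(j) = 0.
  move=> wj; apply: mderiv_polyform => a; apply: mderiv_linear_form.
  by rewrite neq_ltn wj orbT.
exists (on_axis i0 (x0 ^+ (wt i).-1)).
  rewrite rmorphXn; apply: expf_neq0.
  have [s [w sE]] := cone0.
  apply: contra_eq_neq (sE i0) => x00; rewrite eqxx.
  have := congr1 (horner^~ 1) x00; rewrite /on_axis horner_wline horner0.
  rewrite (@meval_eq _ _ _ (fun i => s * dcoord w i)); last first.
    by move=> j; rewrite mul1r sE.
  by rewrite (meval_form_one FS) => ->; rewrite mul0r oner_eq0.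
move=> j wj; rewrite /conormal mderivB qd // subr0 mderivM mderivXn0 ?x0d //.
rewrite mul0r add0r mderivX mnm1E; case: eqP => [->|_].
  have -> : (U_(j) - U_(j) = 0 :> 'X_{1..M})%MM.
    by apply/mnmP => b; rewrite mnmBE subnn mnm0E.
  by rewrite mpolyX0 ?mulr1n ?scale1r mulr1.
by rewrite ?mulr0n ?scale0r mulr0 rmorph0.
Qed.
End GraphEquations.

Section Relation.
Variables (R : realType) (W : vectType R[i]).
Variables (F : forall k, {vspace mform W k}) (r : nat).
Hypothesis FS : symbol_system r.+2 F.
Hypothesis r_gt0 : (0 < r)%N.
Local Notation C := R[i].
Local Notation mform := (mform W).
Local Notation M := #|{: coord_index F r.+2}|.
Local Notation wt := (@coord_weight R W F r.+2).
Local Notation lf k psi := (@linear_form R W F r.+2 k psi).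
Local Notation dcoord := (@diag_coord R W F r.+2).
Local Notation cone := (@cone R W F r.+2).

(** Choose phi <> 0 in F^r. Its contractions by a basis of a complement of its
    kernel are linearly independent elements of F^(r-1), as many as phi has
    essential variables. *)
Theorem exists_relation : exists (p : {mpoly C[M]}) l,
  [/\ vanishing cone p, forall i, ((wt i).*2 <= r.+2)%N -> l i = 0 & p.@[l] != 0].
Proof.
have [phi phiF phi0] : exists2 phi : mform r.+2, phi \in F r.+2 & phi != 0.
  by exists (vpick (F r.+2)); rewrite ?memv_pick // vpick0; apply/eqP/(ss_top FS).
have sphi := ss_sym FS phiF.
pose U := ((lker phi)^C)%VS; pose m := \dim U.
pose e (a : 'I_m) : W := (vbasis U)`_a.
pose psi (a : 'I_m) : mform r.+1 := iota_form (e a) phi.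
have psiF a : psi a \in F r.+1 by apply: (ss_prolong FS _ phiF).2; rewrite /= leqnSn.
have eU a : e a \in U by apply/vbasis_mem/mem_nth; rewrite size_tuple.
have psi_free : free [tuple psi a | a < m].
  apply/freeP => c c0 a.
  pose u := \sum_b c b *: e b.
  have uU : u \in U by apply: memv_suml => b _; apply: memvZ.
  have uK : u \in lker phi.
    rewrite memv_ker linear_sum -[X in _ == X]c0; apply/eqP; apply: eq_bigr => b _.
    by rewrite linearZ -tnth_nth tnth_mktuple.
  have u0 : u = 0.
    apply/eqP; rewrite -memv0 -(capv_compl (lker phi)) memv_cap uK; exact: uU.
  by have /freeP/(_ c u0 a) := basis_free (vbasisP U).
(* phi and its derivatives only depend on the projection to the complement *)
have restrict w : exists x : 'I_m -> C,
    mdiag w phi = mdiag (\sum_b x b *: e b) phi /\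
    forall a, mdiag w (psi a) = mdiag (\sum_b x b *: e b) (psi a).
  have : w \in (U + lker phi)%VS by rewrite addvC addv_complf memvf.
  case/memv_addP => u uU [z zK ->].
  have z0 : iota_form z phi = 0 by apply/eqP; rewrite -memv_ker.
  exists (fun b => coord (vbasis U) b u); rewrite -(coord_vbasis uU).
  split=> [|a]; first exact: mdiag_kernel.
  apply: mdiag_kernel; first exact: symform_iota.
  by rewrite symform_iotaC // z0; apply: (@zero_lfunE _ W (mform r) (e a)).
pose P (i : 'I_m.+1) : {mpoly C[m]} :=
  if unlift ord0 i is Some a then polyform e (fun b => 'X_b) (psi a)
  else polyform e (fun b => 'X_b) phi.
have [Q Q0 QP] := algebraic_dependence P.
(* a point at infinity at which the leading form of the relation does not
   vanish; its coordinates are prescribed values for phi and psi *)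
have [eta Qeta] : exists eta, (pihomog mdeg (msize Q).-1 Q).@[eta] != 0.
  apply: contrapT => h; have /negP := pihomog_top_neq0 Q0; apply.
  apply/eqP; apply: mpoly_eq0_fun => x; apply/eqP/negPn/negP => hx.
  by apply: h; exists x.
have rM : (r.+1 < r.+3)%N by [].
pose kr : 'I_r.+3 := Ordinal rM.
pose x0 := lf ord0 (form_one W r.+2).
pose Z (i : 'I_m.+1) : {mpoly C[M]} :=
  if unlift ord0 i is Some a then lf kr (psi a) else lf ord_max phi.
have phi_free : free [tuple phi] by rewrite seq1_free.
(* the point l has the prescribed components in weights r and r - 1, and no
   others; both weights exceed r/2 as r >= 3 *)
have [d1 d1E] := functional_on_free (fun=> eta ord0) phi_free.
have [d2 d2E] := functional_on_free (fun a => eta (lift ord0 a)) psi_free.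
have [del1 [del1r del1E]] :=
  @dependent_update (fun k => 'Hom(mform k, C^o)) (fun k => 0) r.+2 d1.
have [del [delr delE]] :=
  @dependent_update (fun k => 'Hom(mform k, C^o)) del1 r.+1 d2.
pose l (i : 'I_M) : C := del _ (basis_form (enum_val i)).
exists (homogenize Q x0 Z), l; split.
- apply/vanishing_coneP => s w.
  have [x [xphi xpsi]] := restrict w.
  rewrite (@meval_homogenize_cone _ _ _ Q x0 Z _ s (fun i => (P i).@[x])).
  + by rewrite QP mulr0.
  + exact: meval_form_one.
  move=> i; rewrite /Z /P; case: (unliftP ord0 i) => [a|] _.
    rewrite meval_linear_form_cone ?psiF // meval_polyform xpsi.
    by under [in RHS]eq_bigr do rewrite mevalXU.
  rewrite meval_linear_form_cone ?phiF // meval_polyform xphi.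
  by under [in RHS]eq_bigr do rewrite mevalXU.
- move=> i wi; rewrite /l.
  have w1 : wt i != r.+1 by apply: contraTneq wi => ->; lia.
  have w2 : wt i != r.+2 by apply: contraTneq wi => ->; lia.
  by rewrite delE // del1E // zero_lfunE.
rewrite (@meval_homogenize_infinity _ _ _ Q x0 Z _ eta) //.
  by rewrite meval_linear_form ?form_one_in // delE // del1E // zero_lfunE.
move=> i; rewrite /Z; case: unliftP => [a|] ->.
  rewrite (meval_linear_form del (psiF a : psi a \in F kr)) delr.
  by rewrite -d2E -tnth_nth tnth_mktuple.
rewrite (meval_linear_form del (phiF : (phi : mform (@ord_max r.+2)) \in F (@ord_max r.+2))).
rewrite delE ?del1r; last by rewrite /= eqn_leq ltnn.
exact: (d1E ord0).
Qed.
End Relation.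

(** The contradiction: few generators would force the relation to vanish at
    the point l. *)
Theorem cone_ideal_needs_generators (R : realType) (W : vectType R[i])
    (F : forall k, {vspace mform W k}) r c
    (f : 'I_c -> {mpoly R[i][#|{: coord_index F r}|]}) :
  symbol_system r F -> (3 <= r)%N -> (c <= #|[set i | 2 <= @coord_weight R W F r i]|)%N ->
  ~ generates (vanishing (@cone R W F r)) f.
Proof.
case: r f => [|[|r]] // f FS r3 cN gen.
have [i0 [wt0 cone0]] := exists_origin FS.
have [p [l [pJ l0 pl]]] := exists_relation FS r3.
move/eqP: pl; apply.
apply: (few_generators_vanish (wt := @coord_weight R W F r.+2) (r := r.+2) (i0 := i0)
  _ _ cone0 wt0 _ _ _ gen cN pJ l0).
- exact: cone_scale.
- exact: cone_weighted.
- by move=> i; rewrite /coord_weight -ltnS.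
- exact: cone_spans.
- by move=> i; apply: exists_graph_equation.
Qed.

(** * Forms on projective space *)

Lemma mpoly_linear_substitution (K : numFieldType) n m (L : 'I_n -> 'I_m -> K)
    (p : {mpoly K[n]}) :
  exists q : {mpoly K[m]}, forall x, q.@[x] = p.@[fun i => \sum_j L i j * x j].
Proof.
exists (p \mPo [tuple \sum_j L i j *: 'X_j | i < n]) => x.
rewrite comp_mpoly_meval; apply: meval_eq => i.
rewrite tnth_mktuple raddf_sum; apply: eq_bigr => j _ /=.
by rewrite mevalZ mevalXU.
Qed.

Lemma dhomog_of_meval (K : numFieldType) n d (p : {mpoly K[n]}) :
  (forall s x, p.@[fun i => s * x i] = s ^+ d * p.@[x]) -> p \is d.-homog.
Proof.
move=> ps; have wlineE x : wline (fun _ => 1%N) x p = p.@[x] *: 'X^d.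
  apply/eqP; rewrite -subr_eq0; apply/eqP/poly_eq0_fun => s _.
  by rewrite hornerD hornerN hornerZ hornerXn horner_wline ps mulrC subrr.
have [D pE] := pihomog_sum mdeg p; rewrite pE.
apply: rpred_sum => b _; have [<-|bd] := eqVneq (b : nat) d; first exact: pihomogP.
rewrite (_ : pihomog _ _ _ = 0) ?rpred0 //; apply: mpoly_eq0_fun => x.
by rewrite pihomog_mdeg -coef_wline wlineE coefZ coefXn (negPf bd) mulr0.
Qed.

Section Evalv.
Variables (R : realType) (V : vectType R[i]).
Local Notation C := R[i].
Implicit Types (p q : {mpoly C[\dim {:V}]}) (v : V).

Lemma evalvZ d p s v : p \is d.-homog -> evalv p (s *: v) = s ^+ d * evalv p v.
Proof.
move=> pd; rewrite /evalv -(dhomog_meval _ _ pd); apply: meval_eq => i.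
by rewrite linearZ.
Qed.

Lemma meval_evalv p (x : 'I_(\dim {:V}) -> C) :
  p.@[x] = evalv p (\sum_i x i *: (vbasis {:V})`_i).
Proof.
by apply: meval_eq => i; rewrite coord_sum_free // (basis_free (vbasisP _)).
Qed.

Lemma dhomog_of_evalv d p :
  (forall s v, evalv p (s *: v) = s ^+ d * evalv p v) -> p \is d.-homog.
Proof.
move=> ps; apply: dhomog_of_meval => s x; rewrite !meval_evalv -ps.
by rewrite scaler_sumr; congr (evalv p _); apply: eq_bigr => i _; rewrite scalerA.
Qed.

(** Only values are recorded in this and the next lemma: over an infinite
    field they determine the polynomial, which makes every compatibility with
    the ring operations a matter of evaluation. *)
Lemma evalv_pullback n (a : 'I_n -> 'Hom(V, C^o)) (p : {mpoly C[n]}) :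
  exists q, forall v, evalv q v = p.@[fun i => a i v].
Proof.
have [q qE] := mpoly_linear_substitution
   (fun i (j : 'I_(\dim {:V})) => a i (vbasis {:V})`_j : C) p.
exists q => v; rewrite /evalv qE; apply: meval_eq => i.
rewrite [v in RHS](coord_vbasis (memvf v)) linear_sum; apply: eq_bigr => j _.
by rewrite linearZ /= mulrC.
Qed.

Lemma meval_pullback n (g : 'Hom('rV[C]_n, V)) p :
  exists q : {mpoly C[n]}, forall x, q.@[x] = evalv p (g (\row_i x i)).
Proof.
have [q qE] := mpoly_linear_substitution
   (fun i j => coord (vbasis {:V}) i (g (delta_mx 0 j))) p.
exists q => x; rewrite qE; apply: meval_eq => i.
rewrite (row_sum_delta (\row_i x i)) !linear_sum; apply: eq_bigr => j _.
by rewrite !linearZ /= mxE mulrC.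
Qed.

Lemma line_dim v : v != 0 -> \dim <[v]> == 1%N.
Proof. by rewrite dim_vline => ->. Qed.

Definition point v (v0 : v != 0) : proj V := exist _ <[v]>%VS (line_dim v0).

Lemma vanishes_at_line d p v (P : proj V) : p \is d.-homog -> val P = <[v]>%VS ->
  vanishes_at p P <-> evalv p v = 0.
Proof.
move=> pd Pv; split=> [|pv0 u]; first by apply; rewrite Pv memv_line.
by rewrite Pv => /vlineP[s ->]; rewrite (evalvZ _ _ pd) pv0 mulr0.
Qed.

(** A polynomial vanishes on a line through 0 exactly when all its homogeneous
    components do. *)
Lemma hidealP (Z : proj V -> Prop) p :
  hideal Z p <-> forall P, Z P -> vanishes_at p P.
Proof.
split=> [pZ P ZP v vP|pZ d P ZP v vP].
  have [D ->] := pihomog_sum mdeg p; rewrite /evalv raddf_sum big1 // => d _.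
  exact: pZ ZP v vP.
rewrite /evalv pihomog_mdeg; apply: pihomog_vanish => s.
rewrite -[RHS](pZ P ZP (s *: v)) ?memvZ //; apply: meval_eq => i.
by rewrite linearZ.
Qed.
End Evalv.

Lemma evalv_pullback_hom (R : realType) (V1 V2 : vectType R[i]) (h : 'Hom(V1, V2))
    (p : {mpoly R[i][\dim {:V2}]}) :
  exists q : {mpoly R[i][\dim {:V1}]}, (forall v, evalv q v = evalv p (h v)) /\
    forall d, p \is d.-homog -> q \is d.-homog.
Proof.
have [q qE] := evalv_pullback
  (fun i => (linfun (coord (vbasis {:V2}) i : V2 -> R[i]^o) \o h)%VF) p.
have qh v : evalv q v = evalv p (h v).
  by rewrite qE; apply: meval_eq => i; rewrite comp_lfunE lfunE.
exists q; split=> // d pd; apply: dhomog_of_evalv => s v.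
by rewrite !qh linearZ (evalvZ _ _ pd).
Qed.

(** * Euler-symmetric varieties *)

Section EulerSymmetricVariety.
Variables (R : realType) (W V : vectType R[i]) (r : nat).
Variables (F : forall k, {vspace mform W k}) (Z : proj V -> Prop).
Hypothesis FS : symbol_system r F.
Local Notation C := R[i].
Local Notation M := #|{: coord_index F r}|.
Local Notation wt := (@coord_weight R W F r).
Local Notation lf k psi := (@linear_form R W F r k psi).
Local Notation dcoord := (@diag_coord R W F r).
(* f is the given isomorphism, g the inverse of its composition with the
   coordinates on V_F *)
Variable f : 'Hom(V, VF F r).
Variable g : 'Hom('rV[C]_M, V).
Hypothesis gK : forall x, to_coords (f (g x)) = x.
Hypothesis fK : forall v, g (to_coords (f v)) = v.
Hypothesis Zf : forall P : proj V,
  Z P <-> exists Q : proj (VF F r), MF Q /\ val Q = (f @: val P)%VS.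

(** The point of the affine cone over Z with t = 1 that lies over w. *)
Definition param (w : W) : V := g (\row_i dcoord w i).

Lemma to_coords_phi1 w : to_coords (phi_map F r 1 w) = \row_i dcoord w i.
Proof. by apply/rowP => i; rewrite to_coords_phi mxE expr1n mul1r. Qed.

Lemma f_param w : f (param w) = phi_map F r 1 w.
Proof. by apply: (to_coords_inj FS); rewrite gK to_coords_phi1. Qed.

Lemma f_inj : injective f.
Proof. by move=> u v uv; rewrite -(fK u) uv fK. Qed.

Lemma param_neq0 w : param w != 0.
Proof.
apply/eqP => w0.
have d0 i : dcoord w i = 0.
  have := to_coords_phi1 w; rewrite -f_param w0 linear0 linear0.
  by move/rowP/(_ i); rewrite !mxE.
have := meval_form_one FS 1 w; rewrite -(@meval_eq _ _ (fun i => 0 * dcoord w i)).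
  by rewrite meval_form_one // => /esym/eqP; rewrite oner_eq0.
by move=> i; rewrite d0 !mulr0.
Qed.

Lemma phi1_neq0 w : phi_map F r 1 w != 0.
Proof.
rewrite -f_param; apply: contra (param_neq0 w) => /eqP fw.
by apply/eqP/f_inj; rewrite fw linear0.
Qed.

Definition coordV i (v : V) : C^o := to_coords (f v) 0 i.

Lemma coordV_is_linear i : linear (coordV i).
Proof. by move=> a u v; rewrite /coordV !linearP /= !mxE. Qed.

HB.instance Definition _ i :=
  GRing.isLinear.Build C V C^o _ (coordV i) (coordV_is_linear i).

Lemma coords_pullback (p : {mpoly C[M]}) :
  exists q : {mpoly C[\dim {:V}]}, forall v, evalv q v = p.@[fun i => coordV i v].
Proof.
have [q qE] := evalv_pullback (fun i => linfun (coordV i)) p.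
by exists q => v; rewrite qE; apply: meval_eq => i; rewrite lfunE.
Qed.

Lemma coordV_param s w i : coordV i (s *: param w) = s * dcoord w i.
Proof. by rewrite linearZ /= /coordV gK mxE. Qed.

Definition param_point w : proj V := point (param_neq0 w).

Lemma form_vanishes_on_MF (p : {mpoly C[\dim {:VF F r}]}) d :
  p \is d.-homog -> (forall t w, evalv p (phi_map F r t w) = 0) ->
  forall Q, MF Q -> vanishes_at p Q.
Proof.
move=> pd p0 Q MQ; apply: (MQ (fun P => vanishes_at p P)).
  exists (fun q => q = p); split=> [_ ->|P]; first by exists d.
  by split=> [pP _ ->|]; [|apply].
by move=> P [t [w Pw]]; apply/(vanishes_at_line pd Pw).
Qed.

Lemma param_point_in_Z w : Z (param_point w).
Proof.
apply/Zf; exists (point (phi1_neq0 w)); split.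
  by move=> B _; apply; exists 1, w.
by rewrite /= limg_line f_param.
Qed.

(** Membership in the closure is tested on the zero locus of the form. On the
    image of phi_F at t <> 0 one scales by t to reach t = 1; the values at t =
    0 follow since they are those of a polynomial in t. *)
Lemma form_vanishes_on_Z d p : p \is d.-homog ->
  (forall w, evalv p (param w) = 0) -> forall P, Z P -> vanishes_at p P.
Proof.
move=> pd p0 P /Zf[Q [MQ QP]].
have [q [qE qd]] := evalv_pullback_hom (f^-1)%VF p.
have q_f v : evalv q (f v) = evalv p v.
  by rewrite qE lker0_lfunK //; apply/lker0P; exact: f_inj.
have {MQ} qQ : vanishes_at q Q.
  apply: (form_vanishes_on_MF (qd _ pd) _ MQ) => t w.
  have [pt ptE] := meval_pullback g p.
  have qphi s : evalv q (phi_map F r s w) =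
      (wline (fun i => r - wt i)%N (dcoord w) pt).[s].
    rewrite horner_wline ptE -q_f; congr (evalv q _).
    by apply: (to_coords_inj FS); rewrite gK; apply/rowP => i; rewrite to_coords_phi mxE.
  rewrite qphi (_ : wline _ _ _ = 0) ?horner0 //.
  apply: poly_eq0_fun => s s0; rewrite horner_wline ptE.
  rewrite (_ : \row_i _ = s ^+ r *: \row_i dcoord (s^-1 *: w) i).
    by rewrite linearZ (evalvZ _ _ pd) p0 mulr0.
  apply/rowP => i; rewrite !mxE diag_coordZ exprVn.
  have wr : (wt i <= r)%N by rewrite /coord_weight -ltnS.
  have -> : s ^+ r = s ^+ (r - wt i) * s ^+ wt i by rewrite -exprD subnK.
  by rewrite -mulrA mulVKf ?expf_neq0.
by move=> v vP; rewrite -q_f; apply: qQ; rewrite QP memv_img.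
Qed.

Lemma hideal_Z p :
  hideal Z p <-> forall s w, evalv p (s *: param w) = 0.
Proof.
rewrite hidealP; split=> [pZ s w|p0 P ZP v vP].
  by apply: (pZ _ (param_point_in_Z w)); rewrite memvZ //= memv_line.
have : hideal Z p; last by move/hidealP/(_ P ZP v vP).
move=> d; apply: (form_vanishes_on_Z (d := d)); first exact: pihomogP.
move=> w; rewrite /evalv pihomog_mdeg; apply: pihomog_vanish => s.
by rewrite -[RHS](p0 s w); apply: meval_eq => i; rewrite linearZ.
Qed.

(** The change of coordinates is a bijection between polynomials that respects
    sums and products. *)
Lemma generators_in_coords c (h : 'I_c -> {mpoly C[\dim {:V}]}) :
  generated_by (hideal Z) h ->
  exists h' : 'I_c -> {mpoly C[M]}, generates (vanishing (@cone R W F r)) h'.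
Proof.
move=> hgen; have pull p := cid (meval_pullback g p).
pose tr p := sval (pull p).
have trE p x : (tr p).@[x] = evalv p (g (\row_i x i)) by rewrite /tr; case: (pull p).
have tr_cone p : vanishing (@cone R W F r) (tr p) <-> hideal Z p.
  rewrite vanishing_coneP hideal_Z.
  have E s w : (tr p).@[fun i => s * dcoord w i] = evalv p (s *: param w).
    rewrite trE -linearZ; congr (evalv p (g _)).
    by apply/rowP => i; rewrite !mxE.
  by split=> h0 s w; [rewrite -E | rewrite E].
have tr_onto q : exists p, tr p = q.
  have [p pE] := coords_pullback q; exists p; apply/eqP; rewrite -subr_eq0.
  apply/eqP/mpoly_eq0_fun => x; rewrite mevalB trE pE; apply/eqP.
  rewrite subr_eq0; apply/eqP/meval_eq => i.
  by rewrite /coordV gK mxE.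
have tr_sum (k : 'I_c -> {mpoly C[\dim {:V}]}) :
    tr (\sum_i k i * h i) = \sum_i tr (k i) * tr (h i).
  apply/eqP; rewrite -subr_eq0; apply/eqP/mpoly_eq0_fun => x.
  rewrite mevalB trE /evalv !(raddf_sum (meval _)) /= -sumrB big1 // => i _.
  by rewrite !mevalM !trE subrr.
exists (fun i => tr (h i)) => q; split=> [q0|[k ->]].
  have [p pq] := tr_onto q; have /hgen[k pE] : hideal Z p by apply/tr_cone; rewrite pq.
  by exists (fun i => tr (k i)); rewrite -pq pE tr_sum.
have ptr i : exists p, tr p = k i by apply: tr_onto.
pose k' i := sval (cid (ptr i)).
have -> : \sum_i k i * tr (h i) = tr (\sum_i k' i * h i).
  by rewrite tr_sum; apply: eq_bigr => i _; rewrite /k'; case: cid => /= p ->.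
by apply/tr_cone/hgen; exists k'.
Qed.

(** The closure of the image of U. Being defined by forms on P V, it is closed
    without any argument about closures. *)
Definition param_closure (U : W -> Prop) (P : proj V) : Prop :=
  forall d p, p \is d.-homog -> (forall w, U w -> evalv p (param w) = 0) ->
    vanishes_at p P.

Lemma param_closure_sub U : psubset (param_closure U) Z.
Proof.
move=> P UP; apply/Zf.
have fP : \dim (f @: val P) == 1%N.
  have := limg_ker_dim f (val P); rewrite (_ : lker f = 0%VS) ?capv0 ?dimv0 ?add0n.
    by move=> ->; exact: (valP P).
  by apply/eqP/lker0P; exact: f_inj.
exists (exist (fun U => \dim U == 1%N) _ fP : proj (VF F r)); split=> // B [E [Ehom BE]] phiB.
apply/BE => p pE _ /memv_imgP[v vP ->].
have [d pd] := Ehom p pE; have [q [qE qd]] := evalv_pullback_hom f p.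
rewrite -qE; apply: (UP d) vP; first exact: qd.
move=> w _; rewrite qE f_param.
have /BE/(_ p pE) : B (point (phi1_neq0 w)) by apply: phiB; exists 1, w.
by apply; rewrite memv_line.
Qed.

Lemma param_closure_in (U : W -> Prop) w : U w -> param_closure U (param_point w).
Proof.
move=> Uw d p pd p0.
by apply/(@vanishes_at_line _ _ d p (param w) (param_point w) pd erefl)/p0.
Qed.

(** If forms p of A and q of B do not vanish at w and at u in U, then on the
    line through w and u their product is a non-zero polynomial, so both are
    non-zero at some point of the image of U, which then lies neither in A nor
    in B. *)
Lemma param_closure_irreducible (U : W -> Prop) :
  U 0 -> (forall s w u, U w -> U u -> U (w + s *: (u - w))) ->
  zirreducible (param_closure U).
Proof.
move=> U0 Uline; split.
- exists (fun p => (exists d, p \is d.-homog) /\ forall w, U w -> evalv p (param w) = 0).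
  split=> [p []//|P]; split=> [UP p [[d pd] p0]|h d p pd p0]; first exact: UP pd p0.
  by apply: h; split=> //; exists d.
- by exists (param_point 0); apply: param_closure_in.
move=> A B [EA [EAh AE]] [EB [EBh BE]] UAB.
have witness D (E : {mpoly C[\dim {:V}]} -> Prop) :
    (forall p, E p -> exists d, p \is d.-homog) ->
    (forall P, D P <-> forall p, E p -> vanishes_at p P) ->
    ~ psubset (param_closure U) D ->
    exists p w, [/\ E p, U w & evalv p (param w) != 0].
  move=> Eh DE nD; apply: contrapT => no; apply: nD => P UP; apply/DE => p pE.
  have [d pd] := Eh p pE; apply: UP pd _ => w Uw; apply: contrapT => /eqP pw.
  by apply: no; exists p, w.
have [//|nA] := pselect (psubset (param_closure U) A); first by left.
right; apply: contrapT => nB.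
have [p [w [pE Uw pw]]] := witness A EA EAh AE nA.
have [q [u [qE Uu qu]]] := witness B EB EBh BE nB.
have line (k : {mpoly C[\dim {:V}]}) : exists K : {poly C},
    forall s, K.[s] = evalv k (param (w + s *: (u - w))).
  have [kt ktE] := meval_pullback g k.
  exists (mmap (@polyC C) (fun i => line_poly w (u - w) (basis_form (enum_val i))) kt).
  move=> s; rewrite /param -ktE /mmap horner_sum mevalE; apply: eq_bigr => m _.
  rewrite hornerM hornerC /mmap1 horner_prod; congr (_ * _).
  by apply: eq_bigr => i _; rewrite horner_exp horner_line_poly.
have [[Kp KpE] [Kq KqE]] := (line p, line q).
have Kp0 : Kp != 0.
  by apply: contraNneq pw => K0; have := KpE 0; rewrite K0 horner0 scale0r addr0 => <-.
have Kq0 : Kq != 0.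
  apply: contraNneq qu => K0; have := KqE 1; rewrite K0 horner0 scale1r.
  by rewrite addrC subrK => <-.
have /eqP := mulf_neq0 Kp0 Kq0; apply; apply: poly_eq0_fun => s _.
rewrite hornerM KpE KqE.
have := UAB _ (param_closure_in (Uline s _ _ Uw Uu)).
case=> [/AE/(_ p pE)|/BE/(_ q qE)] h0.
  by rewrite h0 ?mul0r //= memv_line.
by rewrite h0 ?mulr0 //= memv_line.
Qed.

(** The subspaces U i spanned by the first i basis vectors give a strictly
    increasing chain: the i-th coordinate on W is the restriction of a linear
    form on V and separates consecutive members. *)
Lemma dim_Z_ge n : (1 <= r)%N -> pdim Z n -> (\dim {:W} <= n)%N.
Proof.
move=> r1 [_ max]; pose b := vbasis {:W}.
pose U i (w : W) := forall j : 'I_(\dim {:W}), (i <= j)%N -> coord b j w = 0.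
apply: (max _ (fun i => param_closure (U i))); split=> i ilt.
  split; last exact: param_closure_sub.
  apply: param_closure_irreducible => [j _|s w u Uw Uu j ij]; first exact: linear0.
  have cB : coord b j (u - w) = 0 by rewrite linearB /= Uw // Uu // subrr.
  by rewrite linearD linearZ /= cB Uw // mulr0 addr0.
split=> [P UP d p pd p0|sub].
  by apply: UP pd _ => w Uw; apply: p0 => j ij; apply: Uw; apply: ltnW.
pose j : 'I_(\dim {:W}) := Ordinal ilt.
have r1' : (1 < r.+1)%N by [].
pose k1 : 'I_r.+1 := Ordinal r1'.
pose co : mform W k1 := linfun (coord b j : W -> C^o).
have coF : co \in F k1 by rewrite [F _](ss_F1 FS) memvf.
(* this linear form vanishes on the image of U i, but not over the basis
   vector b`_i *)
have [p pE] := coords_pullback (lf k1 co).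
have p_param w : evalv p (param w) = coord b j w.
  rewrite pE -[param w]scale1r.
  rewrite (@meval_eq _ _ _ (fun i => 1 * dcoord w i)); last first.
    by move=> l; rewrite coordV_param.
  by rewrite meval_linear_form_cone // mul1r mdiagS /iota_form lfunE.
have pd : p \is 1.-homog.
  apply: dhomog_of_evalv => s v; rewrite !pE /linear_form !raddf_sum mulr_sumr.
  apply: eq_bigr => l _ /=; rewrite !mevalZ !mevalXU linearZ /= expr1.
  by rewrite mulrCA.
have Uj : U i.+1 b`_j.
  move=> l il; rewrite coord_free ?(basis_free (vbasisP _)) //.
  by case: eqP il => // <-; rewrite ltnn.
have p0 w : U i w -> evalv p (param w) = 0 by move=> Uw; rewrite p_param Uw.
have := sub _ (param_closure_in Uj) 1%N p pd p0 (param b`_j) (memv_line _).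
rewrite p_param coord_free ?(basis_free (vbasisP _)) // eqxx => /eqP.
by rewrite oner_eq0.
Qed.

Lemma dim_V : \dim {:V} = M.
Proof.
have kf : lker f = 0%VS by apply/eqP/lker0P; exact: f_inj.
have := limg_ker_dim f fullv; rewrite kf capv0 dimv0 add0n => <-.
rewrite -(dim_VF FS); congr (\dim _); apply/eqP; rewrite eqEsubv subvf /=.
apply/subvP => y _; apply/memv_imgP; exists (g (to_coords y)); rewrite ?memvf //.
by apply: (to_coords_inj FS); rewrite gK.
Qed.

Lemma not_complete_intersection : (3 <= r)%N -> ~ complete_intersection Z.
Proof.
move=> r3 [n [c [Zn dimV [h /generators_in_coords[h' h'gen]]]]].
have r1 : (1 <= r)%N by apply: leq_trans r3.
apply: (cone_ideal_needs_generators FS r3 _ h'gen).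
have wn := dim_Z_ge r1 Zn.
have := etrans (card_wt_ge2 F r1) (esym dim_V); rewrite dimV (ss_F0 FS) (ss_F1 FS).
rewrite !dimvf.
have -> : dim (mform W 0) = 1%N by [].
have -> : dim (mform W 1) = \dim {:W} by rewrite dimvf; exact: muln1.
by move: wn; lia.
Qed.
End EulerSymmetricVariety.

Theorem theorem1p2 (R : realType) (W V : vectType R[i]) (r : nat)
    (F : forall k : nat, {vspace mform W k}) (Z : proj V -> Prop) :
  symbol_system r F ->
  (3 <= r)%N ->
  euler_symmetric_for F r Z ->
  ~ complete_intersection Z.
Proof.
move=> FS r3 [f [[fi fiK fKi] Zf]].
have [g0 g0K Kg0] := of_coords FS.
have f_inj : lker f == 0%VS by apply/lker0P; exact: can_inj fiK.
have f_surj y : f ((f^-1)%VF y) = y.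
  by apply: limg_lfunVK; apply/memv_imgP; exists (fi y); rewrite ?memvf ?fKi.
apply: (@not_complete_intersection R W V r F Z FS f ((f^-1)%VF \o g0)%VF) => //.
- by move=> x; rewrite comp_lfunE f_surj Kg0.
- by move=> v; rewrite comp_lfunE g0K lker0_lfunK.
Qed.
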